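(* Let $X$ be a locally 1-connected space. The functor $\Pi_1^{vert}\colon \mathbf{Top}/_{sl1c}X\to\mathbf{TopGpd}/X$, sending a semilocally 1-connected map $p\colon Y\to X$ to its vertical fundamental groupoid $\Pi_1^{vert}(p)$ (with its projection to $X$) and a map over $X$ to the induced continuous functor, is a simplicial functor for the simplicial enrichments with hom simplicial sets $$[Y_1,Y_2]^{\mathbf{Top}/X}_n=\mathbf{Top}_{/X}(\Delta^n\times Y_1,Y_2),\qquad [Z_1,Z_2]^{\mathbf{TopGpd}/X}_n=\mathbf{TopGpd}_{/X}(\mathrm{codisc}(\mathbf n)\times Z_1,Z_2).$$
   Context: $I=[0,1]$. ''Basic open neighbourhoods'' are members of a chosen basis of the topology. A space is locally 1-connected if it has an open neighbourhood basis of 1-connected (path-connected and simply connected) sets; for such a base space $X$, the basic open sets of $X$ are taken to be 1-connected. A map $p\colon Y\to X$ is semilocally 1-connected (sl1c) if for all $y\in Y$ there are a basic open neighbourhood $U$ of $p(y)$ and a basic open neighbourhood $N$ of $y$ with $p(N)\subset U$ such that: for every map $b\colon\partial I^2\to N$ and every map $c\colon I^2\to U$ with $c|_{\partial I^2}=p\circ b$, there is a map $\ell\colon I^2\to U\times_X Y=p^{-1}(U)$ with $p\circ\ell=c$ and $\ell|_{\partial I^2}=b$. Vertical fundamental groupoid $\Pi_1^{vert}(p)$: the object space is $Y$. Arrows are classes $[f]$ of vertical paths $f\colon I\to Y$ (paths with $p\circ f$ constant) modulo vertical homotopy (homotopy through vertical paths) relative to $\{0,1\}$. Source $s$ and target $t$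 are evaluation at $0$ and $1$, units are constant paths, inversion is path reversal, composition is concatenation. The topology on the set of arrows has as basic open neighbourhoods of $[f]$ the sets $$\langle [f],U,V_0,V_1\rangle=\{[g]\mid \exists\, h\colon I^2\to p^{-1}(U),\ h(0,-)=f,\ h(1,-)=g,\ h(t,\epsilon)\in V_\epsilon \text{ for all } t\in I,\ \epsilon=0,1\},$$ where $U\subset X$ is a basic open neighbourhood of $p(f(0))=p[f]$ and $V_0,V_1\subset Y$ are basic open neighbourhoods of $s[f]$, $t[f]$ respectively. $\mathbf{Top}/_{sl1c}X$ is the full subcategory of $\mathbf{Top}/X$ on the sl1c maps. $\mathbf{TopGpd}/X$ is the category of topological groupoids with a continuous functor to $X$ (viewed as a groupoid with only identity arrows) and continuous functors over $X$. $\Delta^n$ is the standard topological $n$-simplex, and $\Delta^\bullet$ carries its standard cosimplicial structure. $\mathrm{codisc}(\mathbf n)$ is the (topologically discrete) groupoid with $n+1$ objects (corresponding to the vertices of $\Delta^n$) and a unique arrow between any two objects; these form a cosimplicial groupoid $\mathrm{codisc}(\bullet)$. The cosimplicial structures give the simplicial structures on homs, and composition of $n$-simplices is $g\circ(\mathrm{id}\times f)\circ(\mathrm{diag}\times\mathrm{id})$ in both cases. Being a simplicial functor means there are maps of simplicial hom-sets, given on $0$-simplices by the functor $\Pi_1^{vert}$, respecting composition and identities.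
   Formalization: The total space Y of each semilocally 1-connected map is also required to be locally path-connected; this is exactly the condition for the unit map of the vertical fundamental groupoid to be continuous, and it fails for a Cantor space over a point. *)

(* Defs.v *)
From HB Require Import structures.
From mathcomp Require Import all_boot all_order all_algebra generic_quotient.
From mathcomp Require Import all_classical all_reals topology normedtype.
From mathcomp Require Import ring lra.

Set Implicit Arguments.
Unset Strict Implicit.
Unset Printing Implicit Defensive.

Import Order.TTheory GRing.Theory Num.Theory.
Import numFieldTopology.Exports.
Local Open Scope classical_set_scope.
Local Open Scope quotient_scope.
Local Open Scope ring_scope.
#[local] Obligation Tactic := idtac.

Section Continuity.
Implicit Types X Y Z : topologicalType.

Lemma cts_comp X Y Z (g : Y -> Z) (f : X -> Y) :
  continuous g -> continuous f -> continuous (fun x => g (f x)).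
Proof. by move=> cg cf x; apply: (continuous_comp (cf x)); exact: cg. Qed.

Lemma cts_fst X Y : continuous (@fst X Y).
Proof. by move=> x; exact: cvg_fst. Qed.

Lemma cts_snd X Y : continuous (@snd X Y).
Proof. by move=> x; exact: cvg_snd. Qed.

Lemma cts_pair X Y Z (f : X -> Y) (g : X -> Z) :
  continuous f -> continuous g -> continuous (fun x => (f x, g x)).
Proof. by move=> cf cg x; apply: cvg_pair; [exact: cf | exact: cg]. Qed.

Lemma cts_id X : continuous (fun x : X => x).
Proof. by move=> x; exact: cvg_id. Qed.

Lemma cts_cst X Y (y : Y) : continuous (fun _ : X => y).
Proof. by move=> x; exact: cvg_cst. Qed.

Lemma cts_val X (A : set X) : continuous (fun x : A => val x : X).
Proof. exact: initial_continuous. Qed.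

Lemma cts_into X Y (A : set Y) (f : X -> A) :
  continuous (fun x => val (f x) : Y) -> continuous f.
Proof. by move=> cf; apply: (@continuous_comp_initial _ X Y set_val). Qed.

Lemma cts_discrete (T : discreteTopologicalType) X (f : T -> X) : continuous f.
Proof.
move=> x A /nbhs_singleton Afx /=.
by rewrite nbhs_simpl /= nbhs_principalE; apply/principal_filterP.
Qed.

Section Real.
Context {R : realType} (X : topologicalType).
Implicit Types f g : X -> R.

Lemma cts_add f g : continuous f -> continuous g ->
  continuous (fun x => f x + g x).
Proof. by move=> cf cg x; apply: (@cvgD R R^o); [exact: cf|exact: cg]. Qed.

Lemma cts_opp f : continuous f -> continuous (fun x => - f x).
Proof. by move=> cf x; apply: (@cvgN R R^o); exact: cf. Qed.

Lemma cts_mul f g : continuous f -> continuous g ->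
  continuous (fun x => f x * g x).
Proof. by move=> cf cg x; apply: (@cvgM R); [exact: cf|exact: cg]. Qed.

Lemma cts_max f g : continuous f -> continuous g ->
  continuous (fun x => Num.max (f x) (g x)).
Proof. by move=> cf cg x; exact: (continuous_max (cf x) (cg x)). Qed.

Lemma cts_min f g : continuous f -> continuous g ->
  continuous (fun x => Num.min (f x) (g x)).
Proof. by move=> cf cg x; exact: (continuous_min (cf x) (cg x)). Qed.

Lemma cts_sum (J : finType) (P : pred J) (f : J -> X -> R) :
  (forall i, P i -> continuous (f i)) -> continuous (fun x => \sum_(i | P i) f i x).
Proof.
move=> cf; have -> : (fun x => \sum_(i | P i) f i x) =
    (\big[(fun g h x => g x + h x)/(fun=> 0)]_(i | P i) f i).
  apply/funext => x; elim/big_rec2: _ => // i y1 y2 _ ->; by [].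
elim/big_ind: _ => //; first exact: cts_cst.
by move=> *; exact: cts_add.
Qed.

Lemma cts_mxcoord m n (i : 'I_m) (j : 'I_n) :
  continuous (fun M : 'M[R]_(m, n) => M i j).
Proof. exact: coord_continuous. Qed.

Lemma cts_mx m n (f : X -> 'M[R]_(m, n)) :
  (forall i j, continuous (fun x => f x i j)) -> continuous f.
Proof.
move=> cf x A [P MP sPA].
have H : \forall y \near x, forall i j, P i j (f y i j).
  apply: filter_forall => i; apply: filter_forall => j.
  exact: (cf i j x _ (MP i j)).
by apply: filterS H => y Py; apply: sPA.
Qed.

End Real.

Section Glue0.
Context {R : realType} (X Y : topologicalType).
Variables (u : X -> R) (f g : X -> Y).

Lemma cts_glue0 : continuous u -> continuous f -> continuous g ->
  (forall x, u x = 0 -> f x = g x) ->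
  continuous (fun x => if u x <= 0 then f x else g x).
Proof.
move=> cu cf cg fg x A /= nA; rewrite nbhs_simpl /=.
have [ux|ux|/[dup] ux /fg fgx] := ltgtP (u x) 0.
- have nu : \forall y \near x, u y < 0.
    have /cu : nbhs (u x) [set r | r < 0].
      by apply: open_nbhs_nbhs; split; [exact: open_lt|].
    exact.
  move: nA; rewrite ltW // => /cf nA; near=> y => /=.
  have -> : u y <= 0 by apply: ltW; near: y.
  by near: y; exact: nA.
- have nu : \forall y \near x, 0 < u y.
    have /cu : nbhs (u x) [set r | 0 < r].
      by apply: open_nbhs_nbhs; split; [exact: open_gt|].
    exact.
  move: nA; rewrite leNgt ux /= => /cg nA; near=> y => /=.
  rewrite leNgt; have -> /= : 0 < u y by near: y.
  by near: y; exact: nA.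
- move: nA; rewrite ux lexx => nA.
  have nAf := cf x _ nA; have nAg : nbhs x (g @^-1` A) by apply: cg; rewrite -fgx.
  near=> y => /=; case: ifP => _; near: y; [exact: nAf | exact: nAg].
Unshelve. all: by end_near. Qed.

End Glue0.

Lemma cts_glue (R : realType) X Y (u v : X -> R) (f g : X -> Y) :
  continuous u -> continuous v -> continuous f -> continuous g ->
  (forall x, u x = v x -> f x = g x) ->
  continuous (fun x => if u x <= v x then f x else g x).
Proof.
move=> cu cv cf cg fg.
under eq_fun do rewrite -subr_le0.
apply: cts_glue0 => //; first exact/cts_add/cts_opp.
by move=> x /eqP; rewrite subr_eq0 => /eqP; exact: fg.
Qed.
End Continuity.

Definition I01 (R : realType) : Type := set_type (`[0%R, 1%R]%classic : set R).
HB.instance Definition _ (R : realType) :=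
  Topological.copy (I01 R) (set_type (`[0%R, 1%R]%classic : set R)).

Section Interval.
Context {R : realType}.
Implicit Types (s t : I01 R) (x y : R).
Local Notation I := (I01 R).

Definition ival (s : I) : R := val s.

Lemma ival_inj : injective ival.
Proof. exact: val_inj. Qed.

Lemma ival_itv s : 0 <= ival s <= 1.
Proof. by have := set_mem (valP s); rewrite /= in_itv. Qed.

Lemma ival_ge0 s : 0 <= ival s. Proof. by have /andP[] := ival_itv s. Qed.
Lemma ival_le1 s : ival s <= 1. Proof. by have /andP[] := ival_itv s. Qed.

Lemma cts_ival : continuous ival.
Proof. exact: cts_val. Qed.

Lemma clamp_subproof x : Num.max 0 (Num.min x 1) \in (`[0, 1]%classic : set R).
Proof. by rewrite inE /= in_itv /= le_max lexx ge_max ler01 ge_min lexx orbT. Qed.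

Definition clamp x : I :=
  exist (fun y => y \in (`[0, 1]%classic : set R)) _ (clamp_subproof x).

Lemma ivalK x : 0 <= x <= 1 -> ival (clamp x) = x.
Proof. by move=> /andP[x0 x1]; rewrite /ival /= min_l // max_r. Qed.

Lemma clampK s : clamp (ival s) = s.
Proof. by apply: ival_inj; rewrite ivalK // ival_itv. Qed.

Lemma cts_clamp (Z : topologicalType) (f : Z -> R) :
  continuous f -> continuous (fun z => clamp (f z)).
Proof.
move=> cf; apply: cts_into => /=.
by apply: cts_max; [exact: cts_cst | apply: cts_min => //; exact: cts_cst].
Qed.

Definition i0 : I := clamp 0.
Definition i1 : I := clamp 1.

Lemma ival0 : ival i0 = 0. Proof. by rewrite ivalK // lexx ler01. Qed.
Lemma ival1 : ival i1 = 1. Proof. by rewrite ivalK // lexx ler01. Qed.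

Lemma clamp_le0 x : x <= 0 -> clamp x = i0.
Proof.
move=> x0; apply: ival_inj; rewrite ival0 /ival /= min_l ?max_l //.
exact: le_trans x0 ler01.
Qed.

Lemma clamp_ge1 x : 1 <= x -> clamp x = i1.
Proof.
by move=> x1; apply: ival_inj; rewrite ival1 /ival /= min_r // max_r.
Qed.

Definition half1 s : I := clamp (2 * ival s).
Definition half2 s : I := clamp (2 * ival s - 1).
Definition irev s : I := clamp (1 - ival s).
Definition lerp t s s' : I := clamp ((1 - ival t) * ival s + ival t * ival s').

Lemma irevE s : ival (irev s) = 1 - ival s.
Proof. by rewrite ivalK //; have := ival_itv s; lra. Qed.

Lemma half10 : half1 i0 = i0.
Proof. by rewrite /half1 ival0 mulr0. Qed.
Lemma half21 : half2 i1 = i1.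
Proof. by rewrite /half2 ival1; congr clamp; lra. Qed.
Lemma half1_mid s : ival s = 2^-1 -> half1 s = i1.
Proof. by move=> e; rewrite /half1 e; congr clamp; lra. Qed.
Lemma half2_mid s : ival s = 2^-1 -> half2 s = i0.
Proof. by move=> e; rewrite /half2 e; congr clamp; lra. Qed.
Lemma irev0 : irev i0 = i1. Proof. by rewrite /irev ival0 subr0. Qed.
Lemma irev1 : irev i1 = i0. Proof. by rewrite /irev ival1 subrr. Qed.
Lemma lerp0 s s' : lerp i0 s s' = s.
Proof. by rewrite /lerp ival0 subr0 mul1r mul0r addr0 clampK. Qed.
Lemma lerp1 s s' : lerp i1 s s' = s'.
Proof. by rewrite /lerp ival1 subrr mul0r mul1r add0r clampK. Qed.
Lemma lerp_id t s : lerp t s s = s.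
Proof. by rewrite /lerp -mulrDl subrK mul1r clampK. Qed.

Lemma cts_half1 : continuous half1.
Proof. by apply: cts_clamp; apply: cts_mul; [exact: cts_cst | exact: cts_ival]. Qed.
Lemma cts_half2 : continuous half2.
Proof.
apply: cts_clamp; apply: cts_add; last exact: cts_cst.
by apply: cts_mul; [exact: cts_cst | exact: cts_ival].
Qed.
Lemma cts_irev : continuous irev.
Proof.
by apply: cts_clamp; apply: cts_add; [exact: cts_cst | exact/cts_opp/cts_ival].
Qed.

Lemma cts_lerp (Z : topologicalType) (t f g : Z -> I) :
  continuous t -> continuous f -> continuous g ->
  continuous (fun z => lerp (t z) (f z) (g z)).
Proof.
move=> ct cf cg.
have ci h : continuous h -> continuous (fun z : Z => ival (h z)).
  by move=> ch; apply: cts_comp ch; exact: cts_ival.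
apply: cts_clamp; apply: cts_add; apply: cts_mul; try exact: ci.
by apply: cts_add; [exact: cts_cst | exact/cts_opp/ci].
Qed.

(** Gluing two maps [f] and [g] on [Z * I] along [f (-, 1) = g (-, 0)] *)
Lemma cts_glueI (Z Y : topologicalType) (u : Z -> I) (f g : Z -> I -> Y) :
  continuous u -> continuous (fun z => f z.1 z.2) ->
  continuous (fun z => g z.1 z.2) ->
  (forall z, ival (u z) = 2^-1 -> f z i1 = g z i0) ->
  continuous (fun z => if ival (u z) <= 2^-1 then f z (half1 (u z))
                       else g z (half2 (u z))).
Proof.
move=> cu cf cg fg.
apply: cts_glue.
- by apply: cts_comp cu; exact: cts_ival.
- exact: cts_cst.
- apply: (cts_comp cf (f := fun z => (z, half1 (u z)))).
  by apply: cts_pair; [exact: cts_id | apply: cts_comp cu; exact: cts_half1].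
- apply: (cts_comp cg (f := fun z => (z, half2 (u z)))).
  by apply: cts_pair; [exact: cts_id | apply: cts_comp cu; exact: cts_half2].
- by move=> z uz; rewrite half1_mid // half2_mid //; exact: fg.
Qed.

End Interval.

Arguments i0 {R}.
Arguments i1 {R}.

Section Paths.
Context {R : realType} {X Y : topologicalType} (p : Y -> X).
Local Notation I := (I01 R).
Implicit Types f g h : I -> Y.

Definition vertical f := forall s, p (f s) = p (f i0).

Definition pconcat f g : I -> Y := fun s =>
  if ival s <= 2^-1 then f (half1 s) else g (half2 s).

Definition preverse f : I -> Y := fun s => f (irev s).

Lemma pconcat0 f g : pconcat f g i0 = f i0.
Proof. by rewrite /pconcat ival0 invr_ge0 ler0n half10. Qed.

Lemma pconcat1 f g : pconcat f g i1 = g i1.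
Proof.
rewrite /pconcat ival1 half21 leNgt.
by have -> : (2^-1 : R) < 1 by lra.
Qed.

Lemma cts_pconcat f g : continuous f -> continuous g -> f i1 = g i0 ->
  continuous (pconcat f g).
Proof.
move=> cf cg fg.
apply: (cts_glueI (u := fun s : I => s) (f := fun _ => f) (g := fun _ => g)) => //.
- exact: cts_id.
- by apply: cts_comp; [exact: cf | exact: cts_snd].
- by apply: cts_comp; [exact: cg | exact: cts_snd].
Qed.

Lemma vertical_pconcat f g : vertical f -> vertical g -> f i1 = g i0 ->
  vertical (pconcat f g).
Proof.
move=> vf vg fg s; rewrite pconcat0 /pconcat; case: ifP => _; first exact: vf.
by rewrite vg -fg vf.
Qed.

Definition vhomotopic f g := exists H : I * I -> Y,
  [/\ continuous H,
      (forall s, H (i0, s) = f s) /\ (forall s, H (i1, s) = g s),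
      (forall t, H (t, i0) = f i0) /\ (forall t, H (t, i1) = f i1) &
      forall t, vertical (fun s => H (t, s))].

Lemma vhomotopic_ends f g : vhomotopic f g -> f i0 = g i0 /\ f i1 = g i1.
Proof.
by move=> [H [_ [_ H1] [e0 e1] _]]; rewrite -!H1 e0 e1.
Qed.

Lemma vhomotopic_refl f : continuous f -> vertical f -> vhomotopic f f.
Proof.
move=> cf vf; exists (fun z => f z.2); split => //.
by apply: cts_comp; [exact: cf | exact: cts_snd].
Qed.

Lemma vhomotopic_sym f g : vhomotopic f g -> vhomotopic g f.
Proof.
move=> fg; have [e0 e1] := vhomotopic_ends fg.
move: fg => [H [cH [H0 H1] [E0 E1] vH]].
exists (fun z => H (irev z.1, z.2)); split.
- apply: (cts_comp cH (f := fun z : I * I => (irev z.1, z.2))).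
  apply: cts_pair; last exact: cts_snd.
  by apply: cts_comp; [exact: cts_irev | exact: cts_fst].
- by split=> s /=; rewrite ?irev0 ?irev1.
- by split=> s /=; rewrite ?E0 ?E1.
- by move=> t s; exact: vH.
Qed.

Definition vstack (H K : I * I -> Y) : I * I -> Y := fun z =>
  if ival z.1 <= 2^-1 then H (half1 z.1, z.2) else K (half2 z.1, z.2).

Lemma cts_vstack H K : continuous H -> continuous K ->
  (forall s, H (i1, s) = K (i0, s)) -> continuous (vstack H K).
Proof.
move=> cH cK HK.
have c (L : I * I -> Y) : continuous L ->
    continuous (fun z : (I * I) * I => L (z.2, z.1.2)).
  move=> cL; apply: (cts_comp cL (f := fun z : (I * I) * I => (z.2, z.1.2))).
  apply: cts_pair; first exact: cts_snd.
  by apply: cts_comp; [exact: cts_snd | exact: cts_fst].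
apply: (cts_glueI (u := fst) (f := fun z t => H (t, z.2)) (g := fun z t => K (t, z.2))).
- exact: cts_fst.
- exact: c.
- exact: c.
- by move=> z _.
Qed.

Definition hstack (H K : I * I -> Y) : I * I -> Y := fun z =>
  pconcat (fun s => H (z.1, s)) (fun s => K (z.1, s)) z.2.

Lemma cts_hstack H K : continuous H -> continuous K ->
  (forall t, H (t, i1) = K (t, i0)) -> continuous (hstack H K).
Proof.
move=> cH cK HK.
have c (L : I * I -> Y) : continuous L ->
    continuous (fun z : (I * I) * I => L (z.1.1, z.2)).
  move=> cL; apply: (cts_comp cL (f := fun z : (I * I) * I => (z.1.1, z.2))).
  apply: cts_pair; last exact: cts_snd.
  by apply: cts_comp; exact: cts_fst.
apply: (cts_glueI (u := snd) (f := fun z s => H (z.1, s)) (g := fun z s => K (z.1, s))).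
- exact: cts_snd.
- exact: c.
- exact: c.
- by move=> z _.
Qed.

Lemma vstackP (P : I -> Y -> Prop) H K z :
  (forall t s, P s (H (t, s))) -> (forall t s, P s (K (t, s))) ->
  P z.2 (vstack H K z).
Proof. by move=> PH PK; rewrite /vstack; case: ifP. Qed.

Lemma vstack0 H K s : vstack H K (i0, s) = H (i0, s).
Proof. by rewrite /vstack /= ival0 invr_ge0 ler0n half10. Qed.

Lemma vstack1 H K s : vstack H K (i1, s) = K (i1, s).
Proof.
rewrite /vstack /= ival1 half21 leNgt.
by have -> : (2^-1 : R) < 1 by lra.
Qed.

Lemma vhomotopic_trans f g h :
  vhomotopic f g -> vhomotopic g h -> vhomotopic f h.
Proof.
move=> fg [K [cK [K0 K1] [K0' K1'] vK]]; have [e0 e1] := vhomotopic_ends fg.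
move: fg => [H [cH [H0 H1] [H0' H1'] vH]].
exists (vstack H K); split.
- by apply: cts_vstack => // s; rewrite H1 K0.
- by split=> s; rewrite ?vstack0 ?vstack1.
- by split=> t; rewrite /vstack /=; case: ifP; rewrite ?H0' ?H1' ?K0' ?K1'.
- by move=> t s; rewrite /vstack /=; case: ifP => _; [exact: vH | exact: vK].
Qed.

Lemma vhomotopic_pconcat f f' g g' : f i1 = g i0 ->
  vhomotopic f f' -> vhomotopic g g' ->
  vhomotopic (pconcat f g) (pconcat f' g').
Proof.
move=> fg [H [cH [H0 H1] [H0' H1'] vH]] [K [cK [K0 K1] [K0' K1'] vK]].
have HK t : H (t, i1) = K (t, i0) by rewrite H1' K0'.
exists (hstack H K); split.
- exact: cts_hstack.
- by split=> s; rewrite /hstack /pconcat /= ?H0 ?H1 ?K0 ?K1.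
- by split=> t; rewrite /hstack /= ?pconcat0 ?pconcat1.
- by move=> t; exact: (vertical_pconcat (vH t) (vK t) (HK t)).
Qed.

Lemma vhomotopic_preverse f g :
  vhomotopic f g -> vhomotopic (preverse f) (preverse g).
Proof.
move=> [H [cH [H0 H1] [H0' H1'] vH]].
exists (fun z => H (z.1, irev z.2)); split.
- apply: (cts_comp cH (f := fun z : I * I => (z.1, irev z.2))).
  apply: cts_pair; first exact: cts_fst.
  by apply: cts_comp; [exact: cts_irev | exact: cts_snd].
- by split=> s /=; rewrite ?H0 ?H1.
- by split=> t; rewrite /preverse /= ?irev0 ?irev1.
- by move=> t s /=; rewrite vH [RHS]vH.
Qed.

Lemma vhomotopic_reparam f (phi psi : I -> I) :
  continuous f -> vertical f -> continuous phi -> continuous psi ->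
  phi i0 = psi i0 -> phi i1 = psi i1 ->
  vhomotopic (f \o phi) (f \o psi).
Proof.
move=> cf vf cphi cpsi e0 e1.
exists (fun z => f (lerp z.1 (phi z.2) (psi z.2))); split.
- apply: (cts_comp cf (f := fun z : I * I => lerp z.1 (phi z.2) (psi z.2))).
  apply: cts_lerp; first exact: cts_fst.
  + by apply: cts_comp; [exact: cphi | exact: cts_snd].
  + by apply: cts_comp; [exact: cpsi | exact: cts_snd].
- by split=> s /=; rewrite ?lerp0 ?lerp1.
- by split=> t /=; rewrite -?e0 -?e1 lerp_id.
- by move=> t s /=; rewrite vf [RHS]vf.
Qed.

Lemma vhomotopic_reparam_id f (phi : I -> I) :
  continuous f -> vertical f -> continuous phi -> phi i0 = i0 -> phi i1 = i1 ->
  vhomotopic (f \o phi) f.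
Proof.
by move=> *; apply: (@vhomotopic_reparam f phi (fun s => s)) => //; exact: cts_id.
Qed.

Lemma pconcat_cstl f : continuous f -> vertical f ->
  vhomotopic (pconcat (cst (f i0)) f) f.
Proof.
move=> cf vf.
have -> : pconcat (cst (f i0)) f = f \o half2.
  apply/funext => s; rewrite /pconcat /=; case: ifP => // hs.
  by rewrite /half2 clamp_le0 //; lra.
apply: vhomotopic_reparam_id => //.
- exact: cts_half2.
- by rewrite /half2 ival0 clamp_le0 //; lra.
- by rewrite half21.
Qed.

Lemma pconcat_cstr f : continuous f -> vertical f ->
  vhomotopic (pconcat f (cst (f i1))) f.
Proof.
move=> cf vf.
have -> : pconcat f (cst (f i1)) = f \o half1.
  apply/funext => s; rewrite /pconcat /=; case: ifPn => //; rewrite -ltNge => hs.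
  by rewrite /half1 clamp_ge1 //; lra.
apply: vhomotopic_reparam_id => //.
- exact: cts_half1.
- by rewrite half10.
- by rewrite /half1 ival1 clamp_ge1 //; lra.
Qed.

Lemma cts_preverse f : continuous f -> continuous (preverse f).
Proof. by move=> cf; apply: cts_comp; [exact: cf | exact: cts_irev]. Qed.

Lemma preverseK f : preverse (preverse f) = f.
Proof.
apply/funext => s; rewrite /preverse; congr f; apply: ival_inj.
by rewrite !irevE; lra.
Qed.

Lemma vertical_preverse f : vertical f -> vertical (preverse f).
Proof. by move=> vf s; rewrite /preverse vf [RHS]vf. Qed.

Lemma pconcat_preverse f : continuous f -> vertical f ->
  vhomotopic (pconcat f (preverse f)) (cst (f i0)).
Proof.
move=> cf vf.
pose phi (s : I) : I := clamp (Num.min (2 * ival s) (2 - 2 * ival s)).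
have -> : pconcat f (preverse f) = f \o phi.
  apply/funext => s; rewrite /pconcat /preverse /phi /=; case: ifPn => [hs|].
    by rewrite min_l //; lra.
  rewrite -ltNge => hs; rewrite min_r; last by lra.
  congr f; rewrite /irev /half2 ivalK; first by congr clamp; lra.
  by have := ival_le1 s; lra.
apply: (@vhomotopic_reparam f phi (fun=> i0)) => //.
- apply: cts_clamp; apply: cts_min.
    by apply: cts_mul; [exact: cts_cst | exact: cts_ival].
  apply: cts_add; first exact: cts_cst.
  by apply: cts_opp; apply: cts_mul; [exact: cts_cst | exact: cts_ival].
- exact: cts_cst.
- by rewrite /phi ival0 min_l //; [rewrite mulr0 | lra].
- by rewrite /phi ival1 min_r //; [congr clamp; lra | lra].
Qed.

Lemma pconcatA f g h : continuous f -> continuous g -> continuous h ->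
  vertical f -> vertical g -> vertical h -> f i1 = g i0 -> g i1 = h i0 ->
  vhomotopic (pconcat (pconcat f g) h) (pconcat f (pconcat g h)).
Proof.
move=> cf cg ch vf vg vh fg gh.
pose phi (s : I) : I := clamp (Num.min (2 * ival s)
  (Num.min (ival s + 4^-1) (2^-1 * ival s + 2^-1))).
have phi1 s : ival s <= 4^-1 -> ival (phi s) = 2 * ival s.
  move=> hs; have h0 := ival_ge0 s.
  rewrite /phi ivalK; first by rewrite min_l // le_min; apply/andP; split; lra.
  by rewrite min_l ?le_min; [|apply/andP; split]; lra.
have phi2 s : 4^-1 <= ival s <= 2^-1 -> ival (phi s) = ival s + 4^-1.
  move=> hs; rewrite /phi [X in Num.min _ X]min_l; last by lra.
  by rewrite min_r ?ivalK //; lra.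
have phi3 s : 2^-1 <= ival s -> ival (phi s) = 2^-1 * ival s + 2^-1.
  move=> hs; have h1 := ival_le1 s; rewrite /phi [X in Num.min _ X]min_r; last by lra.
  by rewrite min_r ?ivalK //; lra.
have -> : pconcat (pconcat f g) h = (pconcat f (pconcat g h)) \o phi.
  apply/funext => s; have s0 := ival_ge0 s; have s1 := ival_le1 s.
  rewrite /pconcat /=; case: ifPn => [hs|].
    have h1 : ival (half1 s) = 2 * ival s by rewrite ivalK //; lra.
    have [hs4|hs4] := leP (ival s) 4^-1.
      rewrite ifT; last by rewrite h1; lra.
      rewrite ifT; last by rewrite phi1 //; lra.
      by congr f; rewrite /half1 phi1 // -/(half1 s) h1.
    have [e4|e4] := eqVneq (ival s) 4^-1; first by rewrite e4 ltxx in hs4.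
    rewrite ifF ?h1; last by apply/negbTE; rewrite -ltNge; lra.
    have e : ival (phi s) = ival s + 4^-1 by apply: phi2; lra.
    rewrite ifF ?e; last by apply/negbTE; rewrite -ltNge; lra.
    have e' : ival (half2 (phi s)) = 2 * ival s - 2^-1 by rewrite ivalK e; lra.
    rewrite ifT ?e'; last by lra.
    by congr g; rewrite /half1 /half2 e' h1; congr clamp; lra.
  rewrite -ltNge => hs.
  have e : ival (phi s) = 2^-1 * ival s + 2^-1 by apply: phi3; lra.
  rewrite ifF ?e; last by apply/negbTE; rewrite -ltNge; lra.
  have e' : ival (half2 (phi s)) = ival s by rewrite ivalK e; lra.
  rewrite ifF ?e'; last by apply/negbTE; rewrite -ltNge; lra.
  by congr h; rewrite /half2 e'.
apply: vhomotopic_reparam_id => //.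
- by apply: cts_pconcat; rewrite ?pconcat0 //; exact: cts_pconcat.
- by apply: vertical_pconcat; rewrite ?pconcat0 //; exact: vertical_pconcat.
- have cm c : continuous (fun s : I => c * ival s).
    by apply: cts_mul; [exact: cts_cst | exact: cts_ival].
  apply: cts_clamp; apply: cts_min; first exact: cm.
  apply: cts_min; first by apply: cts_add; [exact: cts_ival | exact: cts_cst].
  by apply: cts_add; [exact: cm | exact: cts_cst].
- by apply: ival_inj; rewrite phi1 ival0; lra.
- by apply: ival_inj; rewrite phi3 ival1; lra.
Qed.

End Paths.

Record topgpd := TopGpd {
  gob : topologicalType;
  garr : topologicalType;
  gsrc : garr -> gob;
  gtgt : garr -> gob;
  gid : gob -> garr;
  ginv : garr -> garr;
  (* in diagrammatic order: [a] first, then [b] *)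
  gcomp : forall a b : garr, gtgt a = gsrc b -> garr;
  gsrc_id : forall x, gsrc (gid x) = x;
  gtgt_id : forall x, gtgt (gid x) = x;
  gsrc_inv : forall a, gsrc (ginv a) = gtgt a;
  gtgt_inv : forall a, gtgt (ginv a) = gsrc a;
  gsrc_comp : forall a b e, gsrc (@gcomp a b e) = gsrc a;
  gtgt_comp : forall a b e, gtgt (@gcomp a b e) = gtgt b;
  gcompA : forall a b c eab ebc eabc eabc',
    @gcomp (@gcomp a b eab) c eabc = @gcomp a (@gcomp b c ebc) eabc';
  gcomp_idl : forall a e, @gcomp (gid (gsrc a)) a e = a;
  gcomp_idr : forall a e, @gcomp a (gid (gtgt a)) e = a;
  gcomp_invr : forall a e, @gcomp a (ginv a) e = gid (gsrc a);
  gcomp_invl : forall a e, @gcomp (ginv a) a e = gid (gtgt a);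
  cts_gsrc : continuous gsrc;
  cts_gtgt : continuous gtgt;
  cts_gid : continuous gid;
  cts_ginv : continuous ginv;
  cts_gcomp : continuous
    (fun ab : [set ab : garr * garr | gtgt ab.1 = gsrc ab.2] =>
       gcomp (set_mem (valP ab)))
}.

Arguments gsrc {t} _.
Arguments gtgt {t} _.
Arguments gid {t} _.
Arguments ginv {t} _.
Arguments gcomp {t} a b _.

Lemma gcomp_congr (G : topgpd) (a a' b b' : garr G) e e' :
  a = a' -> b = b' -> gcomp a b e = gcomp a' b' e'.
Proof. by move=> ea eb; subst a' b'; congr gcomp. Qed.

Record gfun (G H : topgpd) := GFun {
  fob : gob G -> gob H;
  farr : garr G -> garr H;
  cts_fob : continuous fob;
  cts_farr : continuous farr;
  farr_src : forall a, gsrc (farr a) = fob (gsrc a);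
  farr_tgt : forall a, gtgt (farr a) = fob (gtgt a);
  farr_id : forall x, farr (gid x) = gid (fob x);
  farr_comp : forall a b e e', farr (gcomp a b e) = gcomp (farr a) (farr b) e'
}.

Lemma gfunP (G H : topgpd) (F F' : gfun G H) :
  fob F =1 fob F' -> farr F =1 farr F' -> F = F'.
Proof.
case: F => o a c1 c2 p1 p2 p3 p4; case: F' => o' a' c1' c2' p1' p2' p3' p4' /=.
move=> /funext eo /funext ea; subst o' a'.
by congr GFun; exact: Prop_irrelevance.
Qed.

Section GFunOps.
Context {G H K : topgpd}.

Definition gfun_id : gfun G G :=
  @GFun G G (fun x => x) (fun a => a) (@cts_id _) (@cts_id _) (fun=> erefl)
    (fun=> erefl) (fun=> erefl)
    (fun a b e e' => @gcomp_congr G a a b b e e' erefl erefl).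

Program Definition gfun_comp (F' : gfun H K) (F : gfun G H) : gfun G K :=
  @GFun G K (fun x => fob F' (fob F x)) (fun a => farr F' (farr F a))
    _ _ _ _ _ _.
Next Obligation. by move=> F' F; apply: cts_comp; exact: cts_fob. Qed.
Next Obligation. by move=> F' F; apply: cts_comp; exact: cts_farr. Qed.
Next Obligation. by move=> F' F a /=; rewrite !farr_src. Qed.
Next Obligation. by move=> F' F a /=; rewrite !farr_tgt. Qed.
Next Obligation. by move=> F' F x /=; rewrite !farr_id. Qed.
Next Obligation.
move=> F' F a b e e' /=.
have e1 : gtgt (farr F a) = gsrc (farr F b) by rewrite farr_tgt farr_src e.
by rewrite (farr_comp e e1) (farr_comp e1 e').
Qed.

End GFunOps.

Section GpdProduct.
Variables G H : topgpd.
Let A : topologicalType := (garr G * garr H)%type.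
Let O : topologicalType := (gob G * gob H)%type.
Let src (a : A) : O := (gsrc a.1, gsrc a.2).
Let tgt (a : A) : O := (gtgt a.1, gtgt a.2).
Let comp (a b : A) (e : tgt a = src b) : A :=
  (gcomp a.1 b.1 (congr1 fst e), gcomp a.2 b.2 (congr1 snd e)).

Let cts_map2 (S S' T T' : topologicalType) (f : S -> S') (g : T -> T') :
  continuous f -> continuous g -> continuous (fun x : S * T => (f x.1, g x.2)).
Proof.
move=> cf cg; apply: cts_pair.
  by apply: cts_comp; [exact: cf | exact: cts_fst].
by apply: cts_comp; [exact: cg | exact: cts_snd].
Qed.

Let cts_compr : continuous
  (fun ab : [set ab : A * A | tgt ab.1 = src ab.2] => comp (set_mem (valP ab))).
Proof.
pose C := [set ab : A * A | tgt ab.1 = src ab.2].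
have m1 (ab : C) : ((val ab).1.1, (val ab).2.1) \in
    [set ab : garr G * garr G | gtgt ab.1 = gsrc ab.2].
  by rewrite inE /=; exact: (congr1 fst (set_mem (valP ab))).
have m2 (ab : C) : ((val ab).1.2, (val ab).2.2) \in
    [set ab : garr H * garr H | gtgt ab.1 = gsrc ab.2].
  by rewrite inE /=; exact: (congr1 snd (set_mem (valP ab))).
have -> : (fun ab : C => comp (set_mem (valP ab))) =
  (fun ab : C =>
    (gcomp _ _ (set_mem (valP (exist (fun x => x \in _) _ (m1 ab)))),
     gcomp _ _ (set_mem (valP (exist (fun x => x \in _) _ (m2 ab)))))).
  by apply/funext => ab; congr (_, _); exact: gcomp_congr.
have c1 : continuous (fun ab : C => (val ab).1) by apply: cts_comp; [exact: cts_fst|exact: cts_val].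
have c2 : continuous (fun ab : C => (val ab).2) by apply: cts_comp; [exact: cts_snd|exact: cts_val].
apply: cts_pair.
- apply: (cts_comp (@cts_gcomp G)); apply: cts_into => /=.
  apply: cts_pair; [move: c1 | move: c2] => c;
  by apply: (cts_comp (@cts_fst _ _) c).
- apply: (cts_comp (@cts_gcomp H)); apply: cts_into => /=.
  apply: cts_pair; [move: c1 | move: c2] => c;
  by apply: (cts_comp (@cts_snd _ _) c).
Qed.

Program Definition gprod : topgpd := @TopGpd O A src tgt
  (fun x => (gid x.1, gid x.2)) (fun a => (ginv a.1, ginv a.2)) comp
  _ _ _ _ _ _ _ _ _ _ _ _ _ _ _ cts_compr.
Next Obligation. by move=> [x y]; rewrite /src /= !gsrc_id. Qed.
Next Obligation. by move=> [x y]; rewrite /tgt /= !gtgt_id. Qed.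
Next Obligation. by move=> a; rewrite /src /tgt /= !gsrc_inv. Qed.
Next Obligation. by move=> a; rewrite /src /tgt /= !gtgt_inv. Qed.
Next Obligation. by move=> a b e; rewrite /src /= !gsrc_comp. Qed.
Next Obligation. by move=> a b e; rewrite /tgt /= !gtgt_comp. Qed.
Next Obligation. by move=> *; congr (_, _); exact: gcompA. Qed.
Next Obligation. by move=> [a b] e; congr (_, _); exact: gcomp_idl. Qed.
Next Obligation. by move=> [a b] e; congr (_, _); exact: gcomp_idr. Qed.
Next Obligation. by move=> [a b] e; congr (_, _); exact: gcomp_invr. Qed.
Next Obligation. by move=> [a b] e; congr (_, _); exact: gcomp_invl. Qed.
Next Obligation. by apply: cts_map2; exact: cts_gsrc. Qed.
Next Obligation. by apply: cts_map2; exact: cts_gtgt. Qed.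
Next Obligation. by apply: cts_map2; exact: cts_gid. Qed.
Next Obligation. by apply: cts_map2; exact: cts_ginv. Qed.

Program Definition gfst : gfun gprod G :=
  @GFun gprod G fst fst (@cts_fst _ _) (@cts_fst _ _) _ _ _ _.
Next Obligation. by []. Qed.
Next Obligation. by []. Qed.
Next Obligation. by []. Qed.
Next Obligation. by move=> *; exact: gcomp_congr. Qed.

Program Definition gsnd : gfun gprod H :=
  @GFun gprod H snd snd (@cts_snd _ _) (@cts_snd _ _) _ _ _ _.
Next Obligation. by []. Qed.
Next Obligation. by []. Qed.
Next Obligation. by []. Qed.
Next Obligation. by move=> *; exact: gcomp_congr. Qed.

Program Definition gpair (K : topgpd) (F : gfun K G) (F' : gfun K H) :
    gfun K gprod :=
  @GFun K gprod (fun x => (fob F x, fob F' x)) (fun a => (farr F a, farr F' a))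
    _ _ _ _ _ _.
Next Obligation. by move=> K F F'; apply: cts_pair; exact: cts_fob. Qed.
Next Obligation. by move=> K F F'; apply: cts_pair; exact: cts_farr. Qed.
Next Obligation. by move=> K F F' a; congr (_, _); exact: farr_src. Qed.
Next Obligation. by move=> K F F' a; congr (_, _); exact: farr_tgt. Qed.
Next Obligation. by move=> K F F' x; congr (_, _); exact: farr_id. Qed.
Next Obligation. by move=> K F F' a b e e'; congr (_, _); exact: farr_comp. Qed.

End GpdProduct.

Program Definition idgpd (X : topologicalType) : topgpd :=
  @TopGpd X X (fun x => x) (fun x => x) (fun x => x) (fun x => x)
    (fun a b _ => a) _ _ _ _ _ _ _ _ _ _ _ _ _ _ _ _.
Solve Obligations with
  try by [move=> * | move=> X; exact: cts_id | move=> X a b e; rewrite e].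
Next Obligation. by move=> X; apply: (cts_comp (@cts_fst _ _)); exact: cts_val. Qed.

Section Codisc.
Variable n : nat.
Let O : topologicalType := discrete_topology 'I_n.+1.
Let A : topologicalType := discrete_topology ('I_n.+1 * 'I_n.+1)%type.

Program Definition codisc : topgpd :=
  @TopGpd O A (fun a => a.1) (fun a => a.2) (fun i => (i, i))
    (fun a => (a.2, a.1)) (fun a b _ => (a.1, b.2)) _ _ _ _ _ _ _ _ _ _ _ _ _ _ _ _.
Solve Obligations with
  try by [move=> * | move=> [] // | exact: cts_discrete].
Next Obligation.
move=> ab A0 /nbhs_singleton /= Aab; rewrite nbhs_simpl /=.
pose D : set (A * A) := [set (val ab)].
have oD : nbhs (val ab) D.
  exists ([set (val ab).1], [set (val ab).2]).
    by split; rewrite /= nbhs_principalE; exact/principal_filterP.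
  by move=> [x y] [/= -> ->]; rewrite /D /=; case: (val ab).
have := @cts_val _ _ ab _ oD; rewrite nbhs_simpl /=; apply: filterS => x /= ->.
exact: Aab.
Qed.

End Codisc.

Section Connectedness.
Variable R : realType.
Local Notation I := (I01 R).

Definition path_connected (T : topologicalType) := forall x y : T,
  exists f : I -> T, [/\ continuous f, f i0 = x & f i1 = y].

Definition simply_connected (T : topologicalType) := forall f : I -> T,
  continuous f -> f i0 = f i1 -> exists H : I * I -> T,
  [/\ continuous H,
      (forall s, H (i0, s) = f s) /\ (forall s, H (i1, s) = f i0) &
      forall t, H (t, i0) = f i0 /\ H (t, i1) = f i1].

Definition one_connected (T : topologicalType) :=
  path_connected T /\ simply_connected T.

Definition locally_one_connected (X : topologicalType) :=
  exists B : set (set X), basis B /\ forall U, B U -> one_connected U.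

Definition locally_path_connected (X : topologicalType) :=
  exists B : set (set X), basis B /\ forall U, B U -> path_connected U.

(** The basic open sets: a basis chosen for every space, made of 1-connected
    sets for the base space [X]. *)
Record chosen_bases (X : topologicalType) := ChosenBases {
  basic :> forall T : topologicalType, set (set T);
  basicP : forall T, basis (@basic T);
  basic_one_connected : forall U, @basic X U -> one_connected U
}.

Arguments basic [X] _ _.

Lemma chosen_bases_exist (X : topologicalType) :
  locally_one_connected X -> inhabited (chosen_bases X).
Proof.
move=> [C [bC oC]].
pose b (T : topologicalType) : set (set T) :=
  if pselect (X = T) is left e
  then eq_rect X (fun T : topologicalType => set (set T)) C T e else open.
have bX : b X = C.
  by rewrite /b; case: pselect => // e; rewrite (Prop_irrelevance e erefl).
have bb T : basis (b T).
  rewrite /b; case: pselect => [e|_]; first by case: T / e.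
  split=> // x A; rewrite nbhsE => -[U [oU Ux] UA]; exists U => //.
by constructor; exists b => // U; rewrite bX; exact: oC.
Qed.

Definition basic_nbhs X (B : chosen_bases X) (T : topologicalType) (x : T)
    (U : set T) := B T U /\ U x.

Definition square_boundary : set (I * I) :=
  [set z | [\/ z.1 = i0, z.1 = i1, z.2 = i0 | z.2 = i1]].

Definition lifts_squares (X Y : topologicalType) (p : Y -> X)
    (U : set X) (N : set Y) :=
  forall (b : square_boundary -> Y) (c : I * I -> X),
    continuous b -> (forall z, N (b z)) ->
    continuous c -> (forall z, U (c z)) ->
    (forall z, c (val z) = p (b z)) ->
  exists l : I * I -> Y,
    [/\ continuous l, forall z, p (l z) = c z & forall z, l (val z) = b z].

Definition sl1c X (B : chosen_bases X) (Y : topologicalType) (p : Y -> X) :=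
  forall y : Y, exists (U : set X) (N : set Y),
    [/\ basic_nbhs B (p y) U, basic_nbhs B y N, p @` N `<=` U &
        lifts_squares p U N].

End Connectedness.

Section BasicNbhs.
Context {R : realType} {X : topologicalType} (B : chosen_bases R X).

Lemma basic_nbhs_nbhs (T : topologicalType) (x : T) U : basic_nbhs B x U -> nbhs x U.
Proof.
by move=> [BU Ux]; apply: open_nbhs_nbhs; split=> //; exact: (basicP B T).1.
Qed.

Lemma nbhs_basic (T : topologicalType) (x : T) A : nbhs x A ->
  exists2 U, basic_nbhs B x U & U `<=` A.
Proof.
by move=> /((basicP B T).2 x) [U [BU Ux] UA]; exists U.
Qed.

End BasicNbhs.

Section VerticalPaths.
Context {R : realType} {X Y : topologicalType} (p : Y -> X).
Local Notation I := (I01 R).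

Record vpath := VPath {
  vpfun :> I -> Y;
  cts_vpath : continuous vpfun;
  vertical_vpath : vertical p vpfun
}.

HB.instance Definition _ := gen_eqMixin vpath.
HB.instance Definition _ := gen_choiceMixin vpath.

Definition vhomotopicb (f g : vpath) : bool := `[< vhomotopic p f g >].

Lemma vhomotopicb_refl : reflexive vhomotopicb.
Proof.
by move=> f; apply/asboolP/vhomotopic_refl; [exact: cts_vpath|exact: vertical_vpath].
Qed.

Lemma vhomotopicb_sym : symmetric vhomotopicb.
Proof. by move=> f g; apply/asboolP/asboolP; exact: vhomotopic_sym. Qed.

Lemma vhomotopicb_trans : transitive vhomotopicb.
Proof.
move=> g f h /asboolP fg /asboolP gh; apply/asboolP.
exact: vhomotopic_trans fg gh.
Qed.

Canonical vhomotopy_equiv :=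
  EquivRel vhomotopicb vhomotopicb_refl vhomotopicb_sym vhomotopicb_trans.

Lemma vertical_cst (y : Y) : vertical p (cst y : I -> Y).
Proof. by []. Qed.

Definition vcst (y : Y) : vpath := VPath (@cts_cst I Y y) (vertical_cst y).

Definition vreverse (f : vpath) : vpath :=
  VPath (cts_preverse (@cts_vpath f)) (vertical_preverse (@vertical_vpath f)).

Definition vconcat (f g : vpath) (e : f i1 = g i0) : vpath :=
  VPath (cts_pconcat (@cts_vpath f) (@cts_vpath g) e)
    (vertical_pconcat (@vertical_vpath f) (@vertical_vpath g) e).

(** The maps [h : I^2 -> U \times_X Y] in the definition of the topology; only
    their sides [t = 0] and [t = 1] are vertical. *)
Definition square (U : set X) (V0 V1 : set Y) (f g : I -> Y) :=
  exists h : I * I -> Y,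
  [/\ continuous h, forall z, U (p (h z)),
      (forall s, h (i0, s) = f s) /\ (forall s, h (i1, s) = g s) &
      forall t, V0 (h (t, i0)) /\ V1 (h (t, i1))].

Lemma square_sym U V0 V1 f g : square U V0 V1 f g -> square U V0 V1 g f.
Proof.
move=> [h [ch Uh [h0 h1] hV]]; exists (fun z => h (irev z.1, z.2)); split=> //.
- apply: (cts_comp ch (f := fun z : I * I => (irev z.1, z.2))).
  apply: cts_pair; last exact: cts_snd.
  by apply: cts_comp; [exact: cts_irev | exact: cts_fst].
- by split=> s /=; rewrite ?irev0 ?irev1.
Qed.

Lemma square_trans U V0 V1 f g k :
  square U V0 V1 f g -> square U V0 V1 g k -> square U V0 V1 f k.
Proof.
move=> [h [ch Uh [h0 h1] hV]] [l [cl Ul [l0 l1] lV]].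
exists (vstack h l); split.
- by apply: cts_vstack => // s; rewrite h1 l0.
- by move=> z; rewrite /vstack; case: ifP.
- by split=> s; rewrite ?vstack0 ?vstack1.
- by move=> t; rewrite /vstack /=; case: ifP.
Qed.

Lemma squareS U V0 V1 U' V0' V1' f g : U `<=` U' -> V0 `<=` V0' -> V1 `<=` V1' ->
  square U V0 V1 f g -> square U' V0' V1' f g.
Proof.
move=> sU s0 s1 [h [ch Uh h01 hV]]; exists h; split => //.
- by move=> z; exact/sU/Uh.
- by move=> t; have [h0 h1] := hV t; split; [exact: s0 | exact: s1].
Qed.

Lemma square_ends U V0 V1 f g : square U V0 V1 f g ->
  [/\ U (p (f i0)), V0 (f i0) & V1 (f i1)] /\
  [/\ U (p (g i0)), V0 (g i0) & V1 (g i1)].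
Proof.
move=> [h [ch Uh [h0 h1] hV]]; rewrite -!h0 -!h1.
have [? ?] := hV i0; have [? ?] := hV i1.
by split; split.
Qed.

Lemma square_vhomotopic (U : set X) (V0 V1 : set Y) f g :
  U (p (f i0)) -> V0 (f i0) -> V1 (f i1) ->
  vhomotopic p f g -> square U V0 V1 f g.
Proof.
move=> Uf V0f V1f [H [cH H01 [H0 H1] vH]]; exists H; split => //.
- by move=> [t s]; rewrite vH H0.
- by move=> t; rewrite H0 H1.
Qed.

End VerticalPaths.

Arguments vpath R {X Y} p.
Arguments cts_vpath {R X Y p} v.
Arguments vertical_vpath {R X Y p} v.

Section Arrows.
Context {R : realType} {X : topologicalType} (B : chosen_bases R X).
Context {Y : topologicalType} (p : Y -> X).
Local Notation I := (I01 R).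

Definition varr : Type := {eq_quot vhomotopy_equiv (R := R) p}.
HB.instance Definition _ := Choice.copy varr {eq_quot vhomotopy_equiv (R := R) p}.

Definition vclass (f : vpath R p) : varr := (\pi_({eq_quot vhomotopy_equiv p}) f)%qT.
Definition vrepr (a : varr) : vpath R p := repr (a : {eq_quot vhomotopy_equiv p}).

Lemma vclassP f g : vclass f = vclass g <-> vhomotopic p f g.
Proof.
split; first by move=> /eqmodP /asboolP.
by move=> h; apply/eqmodP; exact/asboolP.
Qed.

Lemma vreprK a : vclass (vrepr a) = a.
Proof. exact: reprK. Qed.

Lemma vrepr_class f : vhomotopic p (vrepr (vclass f)) f.
Proof. by apply/vclassP; rewrite vreprK. Qed.

(** [<[f], U, V0, V1>] *)
Definition varr_nbhs (f : vpath R p) U V0 V1 : set varr :=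
  [set vclass g | g in [set g : vpath R p | square p U V0 V1 f g]].

Definition varr_basis : set (set varr) :=
  [set S | exists (f : vpath R p) U V0 V1,
    [/\ basic_nbhs B (p (f i0)) U, basic_nbhs B (f i0) V0,
        basic_nbhs B (f i1) V1 & S = varr_nbhs f U V0 V1]].

Lemma varr_nbhsP f g U V0 V1 :
  varr_nbhs f U V0 V1 (vclass g) <-> square p U V0 V1 f g.
Proof.
split; last by exists g.
move=> [k /= fk /vclassP kg]; apply: (square_trans fk).
by have [_ [? ? ?]] := square_ends fk; exact: square_vhomotopic.
Qed.

Lemma varr_basis_cover : \bigcup_(S in varr_basis) S = setT.
Proof.
apply/seteqP; split => // a _; rewrite -(vreprK a); set f := vrepr a.
have [U BU _] := nbhs_basic B (@filterT _ (nbhs (p (f i0))) _).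
have [V0 BV0 _] := nbhs_basic B (@filterT _ (nbhs (f i0)) _).
have [V1 BV1 _] := nbhs_basic B (@filterT _ (nbhs (f i1)) _).
exists (varr_nbhs f U V0 V1); first by exists f, U, V0, V1.
apply/varr_nbhsP; apply: square_vhomotopic; [exact: BU.2|exact: BV0.2|exact: BV1.2|].
by apply: vhomotopic_refl; [exact: cts_vpath|exact: vertical_vpath].
Qed.

Lemma varr_nbhs_recenter (f g : vpath R p) U V0 V1 U' V0' V1' :
  square p U V0 V1 f g -> U' `<=` U -> V0' `<=` V0 -> V1' `<=` V1 ->
  varr_nbhs g U' V0' V1' `<=` varr_nbhs f U V0 V1.
Proof.
move=> fg sU s0 s1 _ [k /= gk <-]; apply/varr_nbhsP; apply: (square_trans fg).
exact: squareS gk.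
Qed.

Lemma varr_basis_join (S S' : set varr) a : varr_basis S -> varr_basis S' ->
  S a -> S' a -> exists S0, [/\ varr_basis S0, S0 a & S0 `<=` S `&` S'].
Proof.
rewrite -(vreprK a); move: (vrepr a) => g.
move=> [f [U [V0 [V1 [BU BV0 BV1 ->]]]]] [f' [U' [V0' [V1' [BU' BV0' BV1' ->]]]]].
move=> /varr_nbhsP fg /varr_nbhsP fg'.
have [_ [gU g0 g1]] := square_ends fg; have [_ [gU' g0' g1']] := square_ends fg'.
have nI (T : topologicalType) (x y z : T) W W' : basic_nbhs B y W ->
    basic_nbhs B z W' -> W x -> W' x ->
    exists2 W0, basic_nbhs B x W0 & W0 `<=` W `&` W'.
  move=> [BW _] [BW' _] Wx Wx'; apply: nbhs_basic.
  by apply: filterI; apply: (@basic_nbhs_nbhs _ _ B).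
have [U0 BU0 sU0] := nI _ _ _ _ _ _ BU BU' gU gU'.
have [W0 BW0 sW0] := nI _ _ _ _ _ _ BV0 BV0' g0 g0'.
have [W1 BW1 sW1] := nI _ _ _ _ _ _ BV1 BV1' g1 g1'.
exists (varr_nbhs g U0 W0 W1); split; first by exists g, U0, W0, W1.
  apply/varr_nbhsP; apply: square_vhomotopic; [exact: BU0.2|exact: BW0.2|exact: BW1.2|].
  by apply: vhomotopic_refl; [exact: cts_vpath|exact: vertical_vpath].
move=> x x0; split; move: x0.
- by apply: varr_nbhs_recenter => // y; [move/sU0|move/sW0|move/sW1] => -[].
- by apply: varr_nbhs_recenter => // y; [move/sU0|move/sW0|move/sW1] => -[].
Qed.

End Arrows.

Arguments varr R {X Y} p.
(** [varr R p] with the topology generated by the sets [<[f], U, V0, V1>] *)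
Definition pi1_arr (R : realType) X (B : chosen_bases R X) (Y : topologicalType)
  (p : Y -> X) : Type := varr R p.
HB.instance Definition _ R X B Y p :=
  Choice.copy (@pi1_arr R X B Y p) (varr R p).
HB.instance Definition _ R X B Y p :=
  @isBaseTopological.Build (@pi1_arr R X B Y p) (set (varr R p))
    (@varr_basis R X B Y p) id (@varr_basis_cover R X B Y p) (@varr_basis_join R X B Y p).

Section SimplyConnected.
Context {R : realType}.
Local Notation I := (I01 R).

Lemma simply_connected_homotopic (T : topologicalType) (f g : I -> T) :
  simply_connected R T -> continuous f -> continuous g ->
  f i0 = g i0 -> f i1 = g i1 ->
  vhomotopic (fun=> (0 : R)) f g.
Proof.
move=> sT cf cg e0 e1; set q := fun=> _.
have v (k : I -> T) : vertical q k by [].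
have e1' : f i1 = preverse g i0 by rewrite /preverse irev0.
have crg := cts_preverse cg.
have loop : vhomotopic q (pconcat f (preverse g)) (cst (f i0)).
  have [] := sT (pconcat f (preverse g)); first exact: cts_pconcat.
    by rewrite pconcat0 pconcat1 /preverse irev1.
  move=> H [cH [H0 H1] Ht]; exists H; split => //.
  - by split=> s; rewrite ?H0 ?H1 ?pconcat0.
  - split=> s; have [h0 h1] := Ht s; rewrite ?h0 ?h1 //.
have rg : vhomotopic q (pconcat (preverse g) g) (cst (f i1)).
  have := pconcat_preverse crg (v (preverse g)).
  by rewrite preverseK /preverse irev0 -e1.
have ff : vhomotopic q f f by exact: vhomotopic_refl.
have gg : vhomotopic q g g by exact: vhomotopic_refl.
apply: vhomotopic_trans (vhomotopic_sym (pconcat_cstr cf (v f))) _.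
have s1 : vhomotopic q (pconcat f (cst (f i1))) (pconcat f (pconcat (preverse g) g)).
  by apply: vhomotopic_pconcat => //; exact: vhomotopic_sym.
apply: (vhomotopic_trans s1).
have s2 := pconcatA cf crg cg (v f) (v (preverse g)) (v g) e1'.
apply: (vhomotopic_trans (vhomotopic_sym (s2 _))); first by rewrite /preverse irev1.
have s3 : vhomotopic q (pconcat (pconcat f (preverse g)) g) (pconcat (cst (f i0)) g).
  by apply: vhomotopic_pconcat => //; rewrite pconcat1 /preverse irev1.
apply: (vhomotopic_trans s3).
by rewrite e0; exact: pconcat_cstl.
Qed.

Lemma one_connected_homotopy (X : topologicalType) (U : set X) (f g : I -> X) :
  one_connected R U -> continuous f -> continuous g ->
  (forall s, U (f s)) -> (forall s, U (g s)) ->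
  f i0 = g i0 -> f i1 = g i1 ->
  exists H : I * I -> X, [/\ continuous H, forall z, U (H z),
    (forall s, H (i0, s) = f s) /\ (forall s, H (i1, s) = g s) &
    (forall t, H (t, i0) = f i0) /\ (forall t, H (t, i1) = f i1)].
Proof.
move=> [_ sU] cf cg Uf Ug e0 e1.
pose lift (k : I -> X) (Uk : forall s, U (k s)) (s : I) : U :=
  exist (fun x => x \in U) (k s) (mem_set (Uk s)).
have clift k Uk : continuous k -> continuous (@lift k Uk) by move=> ck; exact: cts_into.
have [] := @simply_connected_homotopic U (lift f Uf) (lift g Ug) sU.
- exact: clift.
- exact: clift.
- exact: val_inj.
- exact: val_inj.
move=> H [cH [H0 H1] [E0 E1] _]; exists (fun z => val (H z)); split.
- by apply: cts_comp cH; exact: cts_val.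
- by move=> z; exact: set_mem (valP (H z)).
- by split=> s; rewrite ?H0 ?H1.
- by split=> s; rewrite ?E0 ?E1.
Qed.

End SimplyConnected.

Section SL1C.
Context {R : realType} {X : topologicalType} (B : chosen_bases R X).
Context {Y : topologicalType} (p : Y -> X).
Local Notation I := (I01 R).

Lemma sl1c_small : sl1c B p -> continuous p ->
  forall y A M, nbhs (p y) A -> nbhs y M ->
  exists U N, [/\ basic_nbhs B (p y) U, basic_nbhs B y N, U `<=` A /\ N `<=` M,
    p @` N `<=` U & @lifts_squares R X Y p U N].
Proof.
move=> sp cp y A M nA nM; have [U [N [BU BN pNU fUN]]] := sp y.
have [U' BU' sU'] := nbhs_basic B (filterI nA (basic_nbhs_nbhs BU)).
have nN' : nbhs y (M `&` N `&` p @^-1` U').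
  apply: filterI; last exact: cp (basic_nbhs_nbhs BU').
  by apply: filterI => //; exact: basic_nbhs_nbhs BN.
have [N' BN' sN'] := nbhs_basic B nN'.
exists U', N'; split=> //.
- by split; [move=> x /sU' [] | move=> x /sN' [[]]].
- by move=> _ [x /sN' [_ Ux] <-].
- move=> b c cb Nb cc Uc cpb; apply: fUN => //.
  + by move=> z; have /sN' [[]] := Nb z.
  + by move=> z; have /sU' [] := Uc z.
Qed.

Lemma square_pconcat (U : set X) (N V0 V1 : set Y) (f g f' g' : I -> Y) :
  continuous p -> one_connected R U -> @lifts_squares R X Y p U N ->
  continuous f -> continuous g -> continuous f' -> continuous g' ->
  vertical p f -> vertical p g -> vertical p f' -> vertical p g' ->
  f i1 = g i0 -> f' i1 = g' i0 ->
  square p U V0 N f f' -> square p U N V1 g g' ->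
  square p U V0 V1 (pconcat f g) (pconcat f' g').
Proof.
move=> cp oU fUN cf cg cf' cg' vf vg vf' vg' e e' sf sg.
have [[Uf0 V0f _] [Uf0' V0f' _]] := square_ends sf.
have [[_ _ V1g] [_ _ V1g']] := square_ends sg.
move: sf sg => [H [cH UH [H0 H1] HV]] [K [cK UK [K0 K1] KV]].
pose a t := H (t, i1); pose b t := K (t, i0).
have ca : continuous a.
  by apply: (cts_comp cH (f := fun t => (t, i1))); apply: cts_pair; [exact: cts_id|exact: cts_cst].
have cb : continuous b.
  by apply: (cts_comp cK (f := fun t => (t, i0))); apply: cts_pair; [exact: cts_id|exact: cts_cst].
have ab0 : a i0 = b i0 by rewrite /a /b H0 K0.
have ab1 : a i1 = b i1 by rewrite /a /b H1 K1.
have [c0 [cc0 Uc0 [c00 c01] [c0t c1t]]] := @one_connected_homotopy R X U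
  (fun t => p (a t)) (fun t => p (b t)) oU (cts_comp cp ca) (cts_comp cp cb)
  (fun t => UH _) (fun t => UK _) (congr1 p ab0) (congr1 p ab1).
pose c z := c0 (z.2, z.1).
pose d (z : @square_boundary R) : Y :=
  if ival (val z).2 <= 2^-1 then a (val z).1 else b (val z).1.
have half0 : ival (i0 : I) <= 2^-1 by rewrite ival0; lra.
have half1 : (ival (i1 : I) <= 2^-1) = false.
  by apply/negbTE; rewrite -ltNge ival1; lra.
have cv1 : continuous (fun z : @square_boundary R => (val z).1).
  by apply: cts_comp; [exact: cts_fst | exact: cts_val].
have cv2 : continuous (fun z : @square_boundary R => (val z).2).
  by apply: cts_comp; [exact: cts_snd | exact: cts_val].
have [] := fUN d c.
- apply: cts_glue.
  + by apply: cts_comp cv2; exact: cts_ival.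
  + exact: cts_cst.
  + exact: cts_comp cv1.
  + exact: cts_comp cv1.
  + move=> [[t s] zP] /=; have := set_mem zP => -[] /= -> hs.
    * exact: ab0.
    * exact: ab1.
    * have : (0 : R) < 2^-1 by lra.
      by rewrite -hs ival0 ltxx.
    * have : (2^-1 : R) < 1 by lra.
      by rewrite -hs ival1 ltxx.
- by move=> z; rewrite /d; case: ifP => _; [have [] := HV (val z).1 | have [] := KV (val z).1].
- apply: (cts_comp cc0 (f := fun z : I * I => (z.2, z.1))).
  by apply: cts_pair; [exact: cts_snd | exact: cts_fst].
- by move=> z; exact: Uc0.
- move=> [[t s] zP]; rewrite /c /d /=; have := set_mem zP => -[] /= ->.
  + by rewrite c0t ab0; case: ifP.
  + by rewrite c1t ab1; case: ifP.
  + by rewrite c00 half0.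
  + by rewrite c01 half1.
move=> l [cl pl lb].
have lE z : square_boundary z -> l z = if ival z.2 <= 2^-1 then a z.1 else b z.1.
  by move=> bz; have := lb (exist (fun z => z \in _) z (mem_set bz)).
have lt0 t : l (t, i0) = a t by rewrite lE ?half0 //; apply: Or43.
have lt1 t : l (t, i1) = b t by rewrite lE ?half1 //; apply: Or44.
have l0 s : l (i0, s) = g i0.
  by rewrite lE /=; [rewrite -ab0; case: ifP; rewrite /a H0 | exact: Or41].
have l1 s : l (i1, s) = g' i0.
  by rewrite lE /=; [rewrite -ab1; case: ifP; rewrite /a H1 | exact: Or42].
have cst_l (k h : I -> Y) : continuous h -> continuous k -> vertical p h -> vertical p k ->
    k i1 = h i0 -> vhomotopic p (pconcat k (pconcat (cst (h i0)) h)) (pconcat k h).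
  move=> ch ck vh vk kh; apply: vhomotopic_pconcat; first by rewrite pconcat0.
    exact: vhomotopic_refl.
  exact: pconcat_cstl.
have sq : square p U V0 V1 (pconcat f (pconcat (cst (g i0)) g))
                           (pconcat f' (pconcat (cst (g' i0)) g')).
  exists (hstack H (hstack l K)); split.
  - apply: cts_hstack => //; first by apply: cts_hstack => // t; rewrite lt1.
    by move=> t; rewrite /hstack /= pconcat0 lt0.
  - move=> z; rewrite /hstack /pconcat /=; case: ifP => _; first exact: UH.
    by case: ifP => _; [rewrite pl; exact: Uc0 | exact: UK].
  - split=> s; rewrite /hstack /pconcat /= ?H0 ?H1 ?K0 ?K1 ?l0 ?l1 //.
  - move=> t; rewrite /hstack /= !pconcat0 !pconcat1.
    by split; [have [] := HV t | have [] := KV t].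
apply: (square_trans (g := pconcat f (pconcat (cst (g i0)) g))).
  by apply: square_vhomotopic; rewrite ?pconcat0 ?pconcat1 //; exact/vhomotopic_sym/cst_l.
apply: (square_trans sq).
by apply: square_vhomotopic; rewrite ?pconcat0 ?pconcat1 //; exact: cst_l.
Qed.

End SL1C.

Section Pi1.
Context {R : realType} {X : topologicalType} (B : chosen_bases R X).
Context {Y : topologicalType} (p : Y -> X).
Local Notation I := (I01 R).
Local Notation A := (pi1_arr B p).
Implicit Types (f g : vpath R p) (a b c : A).

Definition pi1_class f : A := vclass f.

Lemma pi1_classP f g : pi1_class f = pi1_class g <-> vhomotopic p f g.
Proof. exact: vclassP. Qed.

Lemma pi1_reprK a : pi1_class (vrepr a) = a.
Proof. exact: vreprK. Qed.

Lemma pi1_classW (P : A -> Prop) : (forall f, P (pi1_class f)) -> forall a, P a.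
Proof. by move=> Pf a; rewrite -(pi1_reprK a). Qed.

Lemma pi1_nbhs f U V0 V1 : nbhs (p (f i0)) U -> nbhs (f i0) V0 ->
  nbhs (f i1) V1 -> nbhs (pi1_class f) (varr_nbhs f U V0 V1 : set A).
Proof.
move=> /(nbhs_basic B)[U' BU sU] /(nbhs_basic B)[V0' B0 s0] /(nbhs_basic B)[V1' B1 s1].
have ff U0 W0 W1 : U0 (p (f i0)) -> W0 (f i0) -> W1 (f i1) -> square p U0 W0 W1 f f.
  move=> *; apply: square_vhomotopic => //.
  by apply: vhomotopic_refl; [exact: cts_vpath|exact: vertical_vpath].
exists (varr_nbhs f U' V0' V1' : set A); split.
- exists [set varr_nbhs f U' V0' V1']; last by rewrite bigcup_set1.
  by move=> _ ->; exists f, U', V0', V1'.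
- by apply/varr_nbhsP; apply: ff; [exact: BU.2|exact: B0.2|exact: B1.2].
- apply: varr_nbhs_recenter => //.
  by apply: ff; [apply/sU/BU.2|apply/s0/B0.2|apply/s1/B1.2].
Qed.

Lemma pi1_nbhsP f (S : set A) : nbhs (pi1_class f) S -> exists U V0 V1,
  [/\ basic_nbhs B (p (f i0)) U, basic_nbhs B (f i0) V0,
      basic_nbhs B (f i1) V1 & varr_nbhs f U V0 V1 `<=` S].
Proof.
move=> [O [[D' sD' <-] [O' DO' O'f] OS]].
have [g [U [V0 [V1 [BU B0 B1 eO']]]]] := sD' _ DO'.
move: O'f; rewrite /= eO' => /varr_nbhsP gf.
have [_ [Uf V0f V1f]] := square_ends gf.
exists U, V0, V1; split; [split=> //; exact: BU.1|split=> //; exact: B0.1|split=> //; exact: B1.1|].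
move=> k fk; apply: OS; exists O' => //=; rewrite eO'.
exact: (varr_nbhs_recenter gf) fk.
Qed.

Lemma pi1_cts (Z : topologicalType) (phi : Z -> A) :
  (forall z f U V0 V1, phi z = pi1_class f ->
     basic_nbhs B (p (f i0)) U -> basic_nbhs B (f i0) V0 ->
     basic_nbhs B (f i1) V1 ->
     \forall z' \near z, varr_nbhs f U V0 V1 (phi z')) ->
  continuous phi.
Proof.
move=> h z S /=; rewrite -(pi1_reprK (phi z)).
move=> /pi1_nbhsP[U [V0 [V1 [BU B0 B1 sS]]]]; rewrite nbhs_simpl /=.
by apply: filterS (h z _ _ _ _ (esym (pi1_reprK _)) BU B0 B1) => z' /sS.
Qed.

Definition pi1_src a : Y := vrepr a i0.
Definition pi1_tgt a : Y := vrepr a i1.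
Definition pi1_id (y : Y) : A := pi1_class (vcst p y).
Definition pi1_inv a : A := pi1_class (vreverse (vrepr a)).
Definition pi1_comp a b (e : pi1_tgt a = pi1_src b) : A := pi1_class (vconcat e).

Lemma pi1_src_class f : pi1_src (pi1_class f) = f i0.
Proof. by have [] := vhomotopic_ends (vrepr_class f). Qed.

Lemma pi1_tgt_class f : pi1_tgt (pi1_class f) = f i1.
Proof. by have [] := vhomotopic_ends (vrepr_class f). Qed.

Lemma pi1_inv_class f : pi1_inv (pi1_class f) = pi1_class (vreverse f).
Proof. by apply/pi1_classP; apply: vhomotopic_preverse; exact: vrepr_class. Qed.

Lemma pi1_comp_class f g e (e' : f i1 = g i0) :
  @pi1_comp (pi1_class f) (pi1_class g) e = pi1_class (vconcat e').
Proof.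
by apply/pi1_classP; apply: vhomotopic_pconcat; [exact: e|exact: vrepr_class|exact: vrepr_class].
Qed.

Lemma pi1_comp_eq a b e f g (e' : f i1 = g i0) :
  a = pi1_class f -> b = pi1_class g -> @pi1_comp a b e = pi1_class (vconcat e').
Proof. by move=> ea eb; subst a b; exact: pi1_comp_class. Qed.

Lemma vhomotopicxx f : vhomotopic p f f.
Proof. by apply: vhomotopic_refl; [exact: cts_vpath | exact: vertical_vpath]. Qed.

Lemma pi1_class_eq f g : (forall s, f s = g s) -> pi1_class f = pi1_class g.
Proof.
move=> fg; apply/pi1_classP.
have -> : (f : I -> Y) = g by exact: funext.
exact: vhomotopicxx.
Qed.

Lemma pi1_src_id y : pi1_src (pi1_id y) = y.
Proof. exact: pi1_src_class. Qed.
Lemma pi1_tgt_id y : pi1_tgt (pi1_id y) = y.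
Proof. exact: pi1_tgt_class. Qed.
Lemma pi1_src_inv a : pi1_src (pi1_inv a) = pi1_tgt a.
Proof. by rewrite pi1_src_class /= /preverse irev0. Qed.
Lemma pi1_tgt_inv a : pi1_tgt (pi1_inv a) = pi1_src a.
Proof. by rewrite pi1_tgt_class /= /preverse irev1. Qed.
Lemma pi1_src_comp a b e : pi1_src (@pi1_comp a b e) = pi1_src a.
Proof. by rewrite pi1_src_class /= pconcat0. Qed.
Lemma pi1_tgt_comp a b e : pi1_tgt (@pi1_comp a b e) = pi1_tgt b.
Proof. by rewrite pi1_tgt_class /= pconcat1. Qed.

Lemma pi1_compA a b c eab ebc eabc eabc' :
  @pi1_comp (@pi1_comp a b eab) c eabc = @pi1_comp a (@pi1_comp b c ebc) eabc'.
Proof.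
have e1 : vconcat eab i1 = vrepr c i0 by rewrite /= pconcat1; exact: ebc.
have e2 : vrepr a i1 = vconcat ebc i0 by rewrite /= pconcat0; exact: eab.
rewrite (pi1_comp_eq eabc e1 erefl (esym (pi1_reprK c))).
rewrite (pi1_comp_eq eabc' e2 (esym (pi1_reprK a)) erefl).
apply/pi1_classP; apply: pconcatA;
  [exact: cts_vpath|exact: cts_vpath|exact: cts_vpath|exact: vertical_vpath|
   exact: vertical_vpath|exact: vertical_vpath|exact: eab|exact: ebc].
Qed.

Lemma pi1_comp_idl a e : @pi1_comp (pi1_id (pi1_src a)) a e = a.
Proof.
have e1 : (vcst p (pi1_src a) : vpath R p) i1 = vrepr a i0 by [].
rewrite (pi1_comp_eq e e1 erefl (esym (pi1_reprK a))) -[RHS]pi1_reprK.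
by apply/pi1_classP; apply: pconcat_cstl; [exact: cts_vpath|exact: vertical_vpath].
Qed.

Lemma pi1_comp_idr a e : @pi1_comp a (pi1_id (pi1_tgt a)) e = a.
Proof.
have e1 : vrepr a i1 = (vcst p (pi1_tgt a) : vpath R p) i0 by [].
rewrite (pi1_comp_eq e e1 (esym (pi1_reprK a)) erefl) -[RHS]pi1_reprK.
by apply/pi1_classP; apply: pconcat_cstr; [exact: cts_vpath|exact: vertical_vpath].
Qed.

Lemma pi1_comp_invr a e : @pi1_comp a (pi1_inv a) e = pi1_id (pi1_src a).
Proof.
have e1 : vrepr a i1 = vreverse (vrepr a) i0 by rewrite /= /preverse irev0.
rewrite (pi1_comp_eq e e1 (esym (pi1_reprK a)) erefl).
by apply/pi1_classP; apply: pconcat_preverse; [exact: cts_vpath|exact: vertical_vpath].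
Qed.

Lemma pi1_comp_invl a e : @pi1_comp (pi1_inv a) a e = pi1_id (pi1_tgt a).
Proof.
have e1 : vreverse (vrepr a) i1 = vrepr a i0 by rewrite /= /preverse irev1.
rewrite (pi1_comp_eq e e1 erefl (esym (pi1_reprK a))).
apply/pi1_classP.
have := pconcat_preverse (cts_vpath (vreverse (vrepr a)))
  (vertical_vpath (vreverse (vrepr a))).
by rewrite /= preverseK /preverse irev0.
Qed.

Lemma cts_pi1_src : continuous pi1_src.
Proof.
move=> a; elim/pi1_classW: a => f S; rewrite pi1_src_class => nS.
rewrite nbhs_simpl /=.
apply: filterS (pi1_nbhs (@filterT _ (nbhs _) _) nS (@filterT _ (nbhs _) _)).
move=> _ [g /= fg <-]; rewrite /preimage /= pi1_src_class.
by have [_ []] := square_ends fg.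
Qed.

Lemma cts_pi1_tgt : continuous pi1_tgt.
Proof.
move=> a; elim/pi1_classW: a => f S; rewrite pi1_tgt_class => nS.
rewrite nbhs_simpl /=.
apply: filterS (pi1_nbhs (@filterT _ (nbhs _) _) (@filterT _ (nbhs _) _) nS).
move=> _ [g /= fg <-]; rewrite /preimage /= pi1_tgt_class.
by have [_ []] := square_ends fg.
Qed.

Lemma cts_pi1_inv : continuous pi1_inv.
Proof.
apply: pi1_cts => a f U V0 V1; elim/pi1_classW: a => g.
rewrite pi1_inv_class => /pi1_classP gf BU B0 B1.
have [e0 e1] := vhomotopic_ends gf; move: e0 e1; rewrite /= /preverse irev0 irev1.
move=> e0 e1; have vg := @vertical_vpath _ _ _ _ g.
apply: filterS (pi1_nbhs (f := g) (U := U) (V0 := V1) (V1 := V0) _ _ _); last first.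
- by rewrite e0; exact: basic_nbhs_nbhs B0.
- by rewrite e1; exact: basic_nbhs_nbhs B1.
- by rewrite -(vg i1) e0; exact: basic_nbhs_nbhs BU.
move=> _ [k /= gk <-]; rewrite pi1_inv_class; apply/varr_nbhsP.
apply: (square_trans (g := preverse g)).
  apply: square_vhomotopic; [exact: BU.2|exact: B0.2|exact: B1.2|].
  exact: vhomotopic_sym.
move: gk => [h [ch Uh [h0 h1] hV]]; exists (fun z => h (z.1, irev z.2)); split => //.
- apply: (cts_comp ch (f := fun z : I * I => (z.1, irev z.2))).
  apply: cts_pair; first exact: cts_fst.
  by apply: cts_comp; [exact: cts_irev | exact: cts_snd].
- by move=> t; have [hV1 hV0] := hV t; split; rewrite /= ?irev0 ?irev1.
Qed.

Lemma cts_pi1_id : locally_path_connected R Y -> continuous p ->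
  continuous pi1_id.
Proof.
move=> [C [bC pC]] cp; apply: pi1_cts => y f U V0 V1 /pi1_classP yf BU B0 B1.
have [/= e0 e1] := vhomotopic_ends yf.
have nW : nbhs y (V0 `&` V1 `&` p @^-1` U).
  apply: filterI; last by apply: cp; rewrite /= e0; exact: basic_nbhs_nbhs BU.
  by apply: filterI; [rewrite e0; exact: basic_nbhs_nbhs B0|rewrite e1; exact: basic_nbhs_nbhs B1].
have [W [CW Wy] sW] := bC.2 y _ nW.
have : nbhs y W by apply: open_nbhs_nbhs; split => //; exact: bC.1.
apply: filterS => y' Wy'; apply/varr_nbhsP.
apply: (square_trans (g := cst y)).
  apply: square_vhomotopic; [exact: BU.2|exact: B0.2|exact: B1.2|exact: vhomotopic_sym].
pose yy : W := exist (fun x => x \in W) y (mem_set Wy).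
pose yy' : W := exist (fun x => x \in W) y' (mem_set Wy').
have [g [cg g0 g1]] := pC _ CW yy yy'.
have Wg s : (V0 `&` V1 `&` p @^-1` U) (val (g s)).
  by apply: sW; exact: set_mem (valP (g s)).
exists (fun z => val (g z.1)); split.
- apply: (cts_comp (@cts_val _ W)); apply: cts_comp; [exact: cg | exact: cts_fst].
- by move=> z; have [_] := Wg z.1.
- by split=> s /=; rewrite ?g0 ?g1.
- by move=> t; have [[]] := Wg t.
Qed.

Lemma cts_pi1_comp : sl1c B p -> continuous p -> continuous
  (fun ab : [set ab : A * A | pi1_tgt ab.1 = pi1_src ab.2] =>
     pi1_comp (set_mem (valP ab))).
Proof.
move=> sp cp; apply: pi1_cts => -[[a b] eab] k U V0 V1 /=.
set e := set_mem _; move: e => /= e.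
have efg : vrepr a i1 = vrepr b i0 := e.
move=> /pi1_classP fgk BU B0 B1.
set f := vrepr a in efg fgk; set g := vrepr b in efg fgk.
have [/=] := vhomotopic_ends fgk; rewrite pconcat0 pconcat1 => e0 e1.
have pfg : p (g i0) = p (f i0) by rewrite -efg (vertical_vpath f).
have [U' [N [BU' BN [sU _] _ fUN]]] : exists U' N,
    [/\ basic_nbhs B (p (g i0)) U', basic_nbhs B (g i0) N, U' `<=` U /\ N `<=` setT,
    p @` N `<=` U' & lifts_squares R p U' N].
  apply: sl1c_small => //; last exact: filterT.
  by rewrite pfg e0; exact: basic_nbhs_nbhs BU.
have nf : nbhs a (varr_nbhs f U' V0 N : set A).
  rewrite -(pi1_reprK a); apply: pi1_nbhs.
  - by rewrite -/f -pfg; exact: basic_nbhs_nbhs BU'.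
  - by rewrite -/f e0; exact: basic_nbhs_nbhs B0.
  - by rewrite -/f efg; exact: basic_nbhs_nbhs BN.
have ng : nbhs b (varr_nbhs g U' N V1 : set A).
  rewrite -(pi1_reprK b); apply: pi1_nbhs.
  - exact: basic_nbhs_nbhs BU'.
  - exact: basic_nbhs_nbhs BN.
  - by rewrite -/g e1; exact: basic_nbhs_nbhs B1.
have nab : nbhs (a, b) ((varr_nbhs f U' V0 N : set A) `*` (varr_nbhs g U' N V1 : set A)).
  by exists (varr_nbhs f U' V0 N : set A, varr_nbhs g U' N V1 : set A).
have := @cts_val _ [set ab : A * A | pi1_tgt ab.1 = pi1_src ab.2] (exist _ (a, b) eab) _ nab.
rewrite nbhs_simpl /=; apply: filterS => -[[a' b'] eab'] /= [].
set e' := set_mem _; move: e' => /= e' [f' /= ff' ea'] [g' /= gg' eb'].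
have efg' : f' i1 = g' i0.
  by move: e'; rewrite -ea' -eb' [LHS]pi1_tgt_class [RHS]pi1_src_class.
rewrite (pi1_comp_eq e' efg' (esym ea') (esym eb')); apply/varr_nbhsP.
apply: (square_trans (g := pconcat f g)).
  by apply: square_vhomotopic; [exact: BU.2|exact: B0.2|exact: B1.2|exact: vhomotopic_sym].
apply: (@squareS _ _ _ p U' V0 V1) => //.
by apply: (square_pconcat (N := N)) => //;
  [exact: basic_one_connected BU'.1|exact: cts_vpath|exact: cts_vpath|exact: cts_vpath
  |exact: cts_vpath|exact: vertical_vpath|exact: vertical_vpath|exact: vertical_vpath
  |exact: vertical_vpath].
Qed.

Definition pi1_gpd (lY : locally_path_connected R Y) (cp : continuous p)
    (sp : sl1c B p) : topgpd :=
  @TopGpd Y A pi1_src pi1_tgt pi1_id pi1_inv pi1_comp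
    pi1_src_id pi1_tgt_id pi1_src_inv pi1_tgt_inv pi1_src_comp pi1_tgt_comp
    pi1_compA pi1_comp_idl pi1_comp_idr pi1_comp_invr pi1_comp_invl
    cts_pi1_src cts_pi1_tgt (cts_pi1_id lY cp) cts_pi1_inv (cts_pi1_comp sp cp).

End Pi1.

Record category := Category {
  cob :> Type;
  hom : cob -> cob -> Type;
  idm : forall A, hom A A;
  comp : forall A B C, hom B C -> hom A B -> hom A C;
  compA : forall A B C D (h : hom C D) (g : hom B C) (f : hom A B),
    comp h (comp g f) = comp (comp h g) f;
  comp_idl : forall A B (f : hom A B), comp (idm B) f = f;
  comp_idr : forall A B (f : hom A B), comp f (idm A) = f
}.

Arguments hom {c} A B.
Arguments idm {c} A.
Arguments comp {c A B C} g f.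

Record functor (C D : category) := Functor {
  fobj :> C -> D;
  fmor : forall A B : C, hom A B -> hom (fobj A) (fobj B);
  fmor_id : forall A : C, fmor (idm A) = idm (fobj A);
  fmor_comp : forall (A B E : C) (g : hom B E) (f : hom A B),
    fmor (comp g f) = comp (fmor g) (fmor f)
}.

Arguments fmor {C D} _ {A B} _.

Record simplicial_op (m n : nat) := SimplicialOp {
  sop :> 'I_m.+1 -> 'I_n.+1;
  sop_homo : forall i j : 'I_m.+1, (i <= j)%N -> (sop i <= sop j)%N
}.

Definition sop_id n : simplicial_op n n :=
  @SimplicialOp n n (fun i => i) (fun _ _ h => h).

Definition sop_comp m n k (a : simplicial_op n k) (b : simplicial_op m n) :
    simplicial_op m k :=
  @SimplicialOp m k (fun i => a (b i)) (fun _ _ h => sop_homo a (sop_homo b h)).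

(** An enrichment of [C] in simplicial sets: [C] is identified with the category
    of 0-simplices by [hom0]. *)
Record simplicial_enrichment (C : category) := SimplicialEnrichment {
  shom : nat -> C -> C -> Type;
  sact : forall m n (A B : C), simplicial_op m n -> shom n A B -> shom m A B;
  sid : forall n (A : C), shom n A A;
  scomp : forall n (A B D : C), shom n B D -> shom n A B -> shom n A D;
  hom0 : forall A B : C, hom A B -> shom 0 A B;
  sact_id : forall n A B (f : shom n A B), sact (sop_id n) f = f;
  sact_comp : forall m n k A B (a : simplicial_op n k) (b : simplicial_op m n)
    (f : shom k A B), sact (sop_comp a b) f = sact b (sact a f);
  scompA : forall n A B D E (h : shom n D E) (g : shom n B D) (f : shom n A B),
    scomp h (scomp g f) = scomp (scomp h g) f;
  scomp_idl : forall n A B (f : shom n A B), scomp (sid n B) f = f;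
  scomp_idr : forall n A B (f : shom n A B), scomp f (sid n A) = f;
  sact_scomp : forall m n A B D (a : simplicial_op m n) (g : shom n B D)
    (f : shom n A B), sact a (scomp g f) = scomp (sact a g) (sact a f);
  sact_sid : forall m n A (a : simplicial_op m n), sact a (sid n A) = sid m A;
  hom0_bij : forall A B, bijective (@hom0 A B);
  hom0_id : forall A, hom0 (idm A) = sid 0 A;
  hom0_comp : forall A B D (g : hom B D) (f : hom A B),
    hom0 (comp g f) = scomp (hom0 g) (hom0 f)
}.

Arguments shom {C} _ _ _ _.
Arguments sact {C s m n A B} _ _.
Arguments sid {C} _ _ _.
Arguments scomp {C s n A B D} _ _.
Arguments hom0 {C} _ {A B} _.

Definition is_simplicial_functor (C D : category) (EC : simplicial_enrichment C)
    (ED : simplicial_enrichment D) (F : functor C D) : Prop :=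
  exists Fs : forall n (A B : C), shom EC n A B -> shom ED n (F A) (F B),
  [/\ forall m n A B (a : simplicial_op m n) (f : shom EC n A B),
        Fs m A B (sact a f) = sact a (Fs n A B f),
      forall A B (f : hom A B), Fs 0 A B (hom0 EC f) = hom0 ED (fmor F f),
      forall n A B E (g : shom EC n B E) (f : shom EC n A B),
        Fs n A E (scomp g f) = scomp (Fs n B E g) (Fs n A B f) &
      forall n A, Fs n A A (sid EC n A) = sid ED n (F A)].

Lemma sval_inj (T : Type) (P : T -> Prop) (x y : {z | P z}) :
  sval x = sval y -> x = y.
Proof.
by case: x y => [x Px] [y Py] /= e; subst y; congr exist; exact: Prop_irrelevance.
Qed.

Section Simplex.
Variable R : realType.

Definition std_simplex n : set 'rV[R]_n.+1 :=
  [set t | (forall i, 0 <= t ord0 i) /\ \sum_i t ord0 i = 1].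

Definition Delta n : topologicalType := set_type (@std_simplex n).

Definition simplex_push m n (a : 'I_m.+1 -> 'I_n.+1) (t : 'rV[R]_m.+1) :
    'rV[R]_n.+1 :=
  \row_j \sum_(i | a i == j) t ord0 i.

Lemma simplex_push_subproof m n (a : 'I_m.+1 -> 'I_n.+1) (t : Delta m) :
  simplex_push a (val t) \in @std_simplex n.
Proof.
have [t0 t1] := set_mem (valP t); rewrite inE; split=> [j|].
  by rewrite mxE; apply: sumr_ge0.
rewrite -[RHS]t1 [RHS](partition_big a predT) //=.
by apply: eq_bigr => j _; rewrite mxE.
Qed.

Definition Delta_map m n (a : 'I_m.+1 -> 'I_n.+1) (t : Delta m) : Delta n :=
  exist (fun x => x \in @std_simplex n) _ (simplex_push_subproof a t).

Lemma cts_Delta_map m n (a : 'I_m.+1 -> 'I_n.+1) : continuous (Delta_map a).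
Proof.
apply: cts_into => /=; apply: cts_mx => i j.
under eq_fun do rewrite mxE.
apply: cts_sum => k _.
apply: (cts_comp (@cts_mxcoord R 1 m.+1 ord0 k)
  (f := fun t : Delta m => val t : 'rV[R]_m.+1)).
exact: cts_val.
Qed.

Lemma Delta_map_id n (t : Delta n) : Delta_map (fun i => i) t = t.
Proof.
apply: val_inj; apply/rowP => j /=; rewrite mxE.
by rewrite (big_pred1 j) // => i; rewrite /= eq_sym.
Qed.

Lemma Delta_map_comp m n k (a : 'I_n.+1 -> 'I_k.+1) (b : 'I_m.+1 -> 'I_n.+1)
    (t : Delta m) : Delta_map (fun i => a (b i)) t = Delta_map a (Delta_map b t).
Proof.
apply: val_inj; apply/rowP => j /=; rewrite !mxE.
rewrite (partition_big b (fun i => a i == j)) //=.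
apply: eq_bigr => i /eqP ai; rewrite mxE; apply: eq_bigl => l.
by rewrite andbC; have [->|] := eqVneq (b l) i; rewrite ?ai ?eqxx.
Qed.

Lemma vertex_subproof n (i : 'I_n.+1) :
  delta_mx ord0 i \in @std_simplex n.
Proof.
rewrite inE; split=> [j|]; first by rewrite mxE ler0n.
rewrite (bigD1 i) //= mxE !eqxx big1 ?addr0 // => j ji.
by rewrite mxE (negPf ji) andbF.
Qed.

Definition vertex n (i : 'I_n.+1) : Delta n :=
  exist (fun x => x \in @std_simplex n) _ (vertex_subproof i).

Lemma Delta0 (t : Delta 0) : t = vertex ord0.
Proof.
apply: val_inj; apply/rowP => j /=; rewrite [j]ord1 !mxE !eqxx.
by have [_] := set_mem (valP t); rewrite big_ord1.
Qed.

End Simplex.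

Section TopOver.
Context {R : realType} {X : topologicalType} (B : chosen_bases R X).

(** Local path-connectedness of the total space is what makes the unit map of
    [\Pi_1^{vert}(p)] continuous: see [cts_pi1_id] and, for the converse,
    [cts_pi1_id_lpc]. A semilocally 1-connected map need not have it: over a
    point, take a Cantor space. *)
Record sl1c_space := Sl1cSpace {
  tot :> topologicalType;
  proj : tot -> X;
  cts_proj : continuous proj;
  sl1c_proj : sl1c B proj;
  lpc_tot : locally_path_connected R tot
}.

Arguments proj {s} _.

Implicit Types Y : sl1c_space.

Definition map_over Y1 Y2 :=
  {f : Y1 -> Y2 | continuous f /\ forall y, proj (f y) = proj y}.

Program Definition map_over_id Y : map_over Y Y := fun y => y.
Next Obligation. by move=> Y; split => //; exact: cts_id. Qed.

Program Definition map_over_comp Y1 Y2 Y3 (g : map_over Y2 Y3)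
    (f : map_over Y1 Y2) : map_over Y1 Y3 := fun y => sval g (sval f y).
Next Obligation.
move=> Y1 Y2 Y3 [g [cg pg]] [f [cf pf]] /=; split; first exact: cts_comp.
by move=> y; rewrite pg pf.
Qed.

Program Definition Top_sl1c : category :=
  @Category sl1c_space map_over map_over_id map_over_comp _ _ _.
Next Obligation. by move=> *; exact: sval_inj. Qed.
Next Obligation. by move=> *; exact: sval_inj. Qed.
Next Obligation. by move=> *; exact: sval_inj. Qed.

Definition simplex_over n Y1 Y2 := {f : Delta R n * Y1 -> Y2 |
  continuous f /\ forall z, proj (f z) = proj z.2}.

Program Definition simplex_over_act m n Y1 Y2 (a : simplicial_op m n)
    (f : simplex_over n Y1 Y2) : simplex_over m Y1 Y2 :=
  fun z => sval f (Delta_map a z.1, z.2).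
Next Obligation.
move=> m n Y1 Y2 a [f [cf pf]] /=; split; last by move=> z; rewrite pf.
apply: (cts_comp cf (f := fun z : Delta R m * Y1 => (Delta_map a z.1, z.2))).
apply: cts_pair; last exact: cts_snd.
by apply: cts_comp; [exact: cts_Delta_map | exact: cts_fst].
Qed.

Program Definition simplex_over_id n Y : simplex_over n Y Y := fun z => z.2.
Next Obligation. by move=> n Y; split => //; exact: cts_snd. Qed.

Program Definition simplex_over_comp n Y1 Y2 Y3 (g : simplex_over n Y2 Y3)
    (f : simplex_over n Y1 Y2) : simplex_over n Y1 Y3 :=
  fun z => sval g (z.1, sval f z).
Next Obligation.
move=> n Y1 Y2 Y3 [g [cg pg]] [f [cf pf]] /=; split; last by move=> z; rewrite pg pf.
apply: (cts_comp cg (f := fun z : Delta R n * Y1 => (z.1, f z))).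
by apply: cts_pair; [exact: cts_fst | exact: cf].
Qed.

Program Definition simplex_over0 Y1 Y2 (f : map_over Y1 Y2) :
    simplex_over 0 Y1 Y2 := fun z => sval f z.2.
Next Obligation.
move=> Y1 Y2 [f [cf pf]] /=; split=> //.
by apply: cts_comp; [exact: cf | exact: cts_snd].
Qed.

Program Definition Top_sl1c_enrichment : simplicial_enrichment Top_sl1c :=
  @SimplicialEnrichment Top_sl1c simplex_over simplex_over_act simplex_over_id
    simplex_over_comp simplex_over0 _ _ _ _ _ _ _ _ _ _.
Next Obligation.
by move=> n Y1 Y2 f; apply: sval_inj; apply/funext => -[t y]; rewrite /= Delta_map_id.
Qed.
Next Obligation.
move=> m n k Y1 Y2 a b f; apply: sval_inj; apply/funext => -[t y] /=.
by rewrite Delta_map_comp.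
Qed.
Next Obligation. by move=> *; exact: sval_inj. Qed.
Next Obligation. by move=> *; exact: sval_inj. Qed.
Next Obligation.
by move=> n Y1 Y2 f; apply: sval_inj; apply/funext => -[].
Qed.
Next Obligation. by move=> *; exact: sval_inj. Qed.
Next Obligation. by move=> *; exact: sval_inj. Qed.
Next Obligation.
move=> Y1 Y2; pose v (y : Y1) := (vertex R (ord0 : 'I_1), y).
have cv : continuous v by apply: cts_pair; [exact: cts_cst | exact: cts_id].
pose inv (f : simplex_over 0 Y1 Y2) : map_over Y1 Y2 :=
  exist _ (fun y => sval f (v y)) (conj (cts_comp (svalP f).1 cv)
    (fun y => (svalP f).2 (v y))).
exists inv => f; apply: sval_inj => //.
by apply/funext => -[t y]; rewrite /= /v -(Delta0 t).
Qed.
Next Obligation. by move=> *; exact: sval_inj. Qed.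
Next Obligation. by move=> *; exact: sval_inj. Qed.

End TopOver.

Arguments proj {R X B s} _.

Section Codisc.

Program Definition codisc_map m n (a : 'I_m.+1 -> 'I_n.+1) :
    gfun (codisc m) (codisc n) :=
  @GFun (codisc m) (codisc n) a (fun ij => (a ij.1, a ij.2)) _ _ _ _ _ _.
Solve Obligations with try by [move=> * | move=> *; exact: cts_discrete].

Definition codisc_cst (G : topgpd) : gfun G (codisc 0).
Proof.
apply: (@GFun G (codisc 0) (fun=> ord0) (fun=> (ord0, ord0))) => //.
- exact: cts_cst.
- exact: cts_cst.
Defined.

End Codisc.

Section GpdOver.
Variable X : topologicalType.

Record gpd_over := GpdOver { gpd :> topgpd; gproj : gfun gpd (idgpd X) }.

Arguments gproj g : clear implicits.

Implicit Types Z : gpd_over.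

Definition gmap_over Z1 Z2 :=
  {F : gfun Z1 Z2 | gfun_comp (gproj Z2) F = gproj Z1}.

Lemma gfun_compA (G H K L : topgpd) (F3 : gfun K L) (F2 : gfun H K) (F1 : gfun G H) :
  gfun_comp F3 (gfun_comp F2 F1) = gfun_comp (gfun_comp F3 F2) F1.
Proof. exact: gfunP. Qed.

Lemma gfun_comp_idl (G H : topgpd) (F : gfun G H) : gfun_comp (gfun_id) F = F.
Proof. exact: gfunP. Qed.

Lemma gfun_comp_idr (G H : topgpd) (F : gfun G H) : gfun_comp F gfun_id = F.
Proof. exact: gfunP. Qed.

Program Definition gmap_over_id Z : gmap_over Z Z := gfun_id.
Next Obligation. by move=> Z; exact: gfunP. Qed.

Program Definition gmap_over_comp Z1 Z2 Z3 (G : gmap_over Z2 Z3)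
    (F : gmap_over Z1 Z2) : gmap_over Z1 Z3 := gfun_comp (sval G) (sval F).
Next Obligation. by move=> Z1 Z2 Z3 [G eG] [F eF] /=; rewrite gfun_compA eG. Qed.

Program Definition TopGpd_over : category :=
  @Category gpd_over gmap_over gmap_over_id gmap_over_comp _ _ _.
Next Obligation. by move=> *; apply: sval_inj; exact: gfunP. Qed.
Next Obligation. by move=> *; apply: sval_inj; exact: gfunP. Qed.
Next Obligation. by move=> *; apply: sval_inj; exact: gfunP. Qed.

Definition gsimplex_over n Z1 Z2 := {F : gfun (gprod (codisc n) Z1) Z2 |
  gfun_comp (gproj Z2) F = gfun_comp (gproj Z1) (gsnd (codisc n) Z1)}.

Program Definition gsimplex_over_act m n Z1 Z2 (a : simplicial_op m n)
    (F : gsimplex_over n Z1 Z2) : gsimplex_over m Z1 Z2 :=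
  gfun_comp (sval F)
    (gpair (gfun_comp (codisc_map a) (gfst (codisc m) Z1)) (gsnd (codisc m) Z1)).
Next Obligation.
move=> m n Z1 Z2 a [F eF] /=; rewrite gfun_compA eF.
exact: gfunP.
Qed.

Program Definition gsimplex_over_id n Z : gsimplex_over n Z Z := gsnd (codisc n) Z.
Next Obligation. by []. Qed.

Program Definition gsimplex_over_comp n Z1 Z2 Z3 (G : gsimplex_over n Z2 Z3)
    (F : gsimplex_over n Z1 Z2) : gsimplex_over n Z1 Z3 :=
  gfun_comp (sval G) (gpair (gfst (codisc n) Z1) (sval F)).
Next Obligation.
move=> n Z1 Z2 Z3 [G eG] [F eF] /=; rewrite gfun_compA eG -eF.
exact: gfunP.
Qed.

Program Definition gsimplex_over0 Z1 Z2 (F : gmap_over Z1 Z2) :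
    gsimplex_over 0 Z1 Z2 := gfun_comp (sval F) (gsnd (codisc 0) Z1).
Next Obligation. by move=> Z1 Z2 [F eF] /=; rewrite gfun_compA eF. Qed.

Program Definition TopGpd_enrichment : simplicial_enrichment TopGpd_over :=
  @SimplicialEnrichment TopGpd_over gsimplex_over gsimplex_over_act
    gsimplex_over_id gsimplex_over_comp gsimplex_over0 _ _ _ _ _ _ _ _ _ _.
Next Obligation.
by move=> n Z1 Z2 F; apply: sval_inj; apply: gfunP => -[] //= [].
Qed.
Next Obligation. by move=> *; apply: sval_inj; exact: gfunP. Qed.
Next Obligation. by move=> *; apply: sval_inj; exact: gfunP. Qed.
Next Obligation. by move=> *; apply: sval_inj; exact: gfunP. Qed.
Next Obligation.
by move=> n Z1 Z2 F; apply: sval_inj; apply: gfunP => -[] //= [].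
Qed.
Next Obligation. by move=> *; apply: sval_inj; exact: gfunP. Qed.
Next Obligation. by move=> *; apply: sval_inj; exact: gfunP. Qed.
Next Obligation.
move=> Z1 Z2.
have inv_subproof (F : gsimplex_over 0 Z1 Z2) :
    gfun_comp (gproj Z2) (gfun_comp (sval F) (gpair (codisc_cst Z1) gfun_id)) = gproj Z1.
  by case: F => F eF /=; rewrite gfun_compA eF; exact: gfunP.
exists (fun F => exist (fun F' : gfun Z1 Z2 => gfun_comp (gproj Z2) F' = gproj Z1)
  _ (inv_subproof F)) => F; apply: sval_inj; apply: gfunP => //=.
- by move=> [i x] /=; rewrite [i]ord1.
- by move=> [[i j] a] /=; rewrite [i]ord1 [j]ord1.
Qed.
Next Obligation. by move=> *; apply: sval_inj; exact: gfunP. Qed.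
Next Obligation. by move=> *; apply: sval_inj; exact: gfunP. Qed.

End GpdOver.

Arguments gproj {X} g.

Section VMap.
Context {R : realType} {X : topologicalType} (B : chosen_bases R X).
Context {Y1 Y2 : topologicalType} (p1 : Y1 -> X) (p2 : Y2 -> X).
Variables (f : Y1 -> Y2) (cf : continuous f) (pf : forall y, p2 (f y) = p1 y).
Local Notation I := (I01 R).

Lemma vertical_map (g : I -> Y1) : vertical p1 g -> vertical p2 (f \o g).
Proof. by move=> vg s; rewrite /= !pf. Qed.

Definition vmap (g : vpath R p1) : vpath R p2 :=
  VPath (cts_comp cf (cts_vpath g)) (vertical_map (vertical_vpath g)).

Definition pi1_map (a : pi1_arr B p1) : pi1_arr B p2 :=
  pi1_class B (vmap (vrepr a)).

Lemma pi1_map_class (g : vpath R p1) :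
  pi1_map (pi1_class B g) = pi1_class B (vmap g).
Proof.
apply/pi1_classP; have [H [cH [H0 H1] [E0 E1] vH]] := vrepr_class g.
exists (fun z => f (H z)); split.
- exact: cts_comp.
- by split=> s; rewrite ?H0 ?H1.
- by split=> t; rewrite ?E0 ?E1.
- by move=> t; apply: (@vertical_map (fun s => H (t, s))).
Qed.

Lemma cts_pi1_map : continuous pi1_map.
Proof.
apply: pi1_cts => a k U V0 V1; elim/(@pi1_classW _ _ B): a => g.
rewrite pi1_map_class => /pi1_classP gk BU B0 B1.
have [/= e0 e1] := vhomotopic_ends gk.
have ng := @pi1_nbhs _ _ B _ _ g U (f @^-1` V0) (f @^-1` V1).
apply: filterS (ng _ _ _); last first.
- by apply: cf; rewrite e1; exact: basic_nbhs_nbhs B1.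
- by apply: cf; rewrite e0; exact: basic_nbhs_nbhs B0.
- by rewrite -pf e0; exact: basic_nbhs_nbhs BU.
move=> _ [l /= gl <-]; rewrite [pi1_map _]pi1_map_class; apply/varr_nbhsP.
apply: (square_trans (g := f \o g)).
  apply: square_vhomotopic; [exact: BU.2|exact: B0.2|exact: B1.2|].
  exact: vhomotopic_sym.
move: gl => [h [ch Uh [h0 h1] hV]]; exists (fun z => f (h z)); split.
- exact: cts_comp.
- by move=> z; rewrite pf.
- by split=> s /=; rewrite ?h0 ?h1.
- exact: hV.
Qed.

End VMap.

Section Pi1Functor.
Context {R : realType} {X : topologicalType} (B : chosen_bases R X).
Implicit Types Y : sl1c_space B.

Definition pi1_of Y : topgpd :=
  pi1_gpd (@lpc_tot _ _ _ Y) (@cts_proj _ _ _ Y) (@sl1c_proj _ _ _ Y).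

Program Definition pi1_proj Y : gfun (pi1_of Y) (idgpd X) :=
  @GFun (pi1_of Y) (idgpd X) proj (fun a => proj (pi1_src a)) _ _ _ _ _ _.
Next Obligation. by move=> Y; exact: cts_proj. Qed.
Next Obligation.
by move=> Y; apply: cts_comp; [exact: cts_proj | exact: cts_pi1_src].
Qed.
Next Obligation. by []. Qed.
Next Obligation. by move=> Y a; symmetry; exact: (vertical_vpath (vrepr a)). Qed.
Next Obligation. by move=> Y y /=; rewrite pi1_src_id. Qed.
Next Obligation. by move=> Y a b e e' /=; rewrite pi1_src_comp. Qed.

Definition pi1_over Y : gpd_over X := GpdOver (pi1_proj Y).

Section Morphism.
Variables (Y1 Y2 : sl1c_space B) (f : map_over Y1 Y2).
Let cf : continuous (sval f) := (svalP f).1.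
Let pf : forall y, proj (sval f y) = proj y := (svalP f).2.

Program Definition pi1_gfun : gfun (pi1_of Y1) (pi1_of Y2) :=
  @GFun (pi1_of Y1) (pi1_of Y2) (sval f) (fun a : pi1_arr B proj => pi1_map cf pf a : pi1_arr B proj) _ _ _ _ _ _.
Next Obligation. exact: cf. Qed.
Next Obligation. exact: cts_pi1_map. Qed.
Next Obligation. by move=> a /=; exact: pi1_src_class. Qed.
Next Obligation. by move=> a /=; exact: pi1_tgt_class. Qed.
Next Obligation. by move=> y /=; rewrite [LHS]pi1_map_class; exact: pi1_class_eq. Qed.
Next Obligation.
move=> a b e e' /=; rewrite [LHS]pi1_map_class.
have e1 : vmap cf pf (vrepr a) i1 = vmap cf pf (vrepr b) i0.
  by rewrite /=; congr (sval f _); exact: e.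
rewrite (pi1_comp_eq e' e1 erefl erefl); apply: pi1_class_eq => t.
by rewrite /= /pconcat; case: ifP.
Qed.

Lemma pi1_gfun_over : gfun_comp (pi1_proj Y2) pi1_gfun = pi1_proj Y1.
Proof.
apply: gfunP => [y|a] /=; first exact: pf.
by rewrite [pi1_src _]pi1_src_class /= pf.
Qed.

Definition pi1_gmap : gmap_over (pi1_over Y1) (pi1_over Y2) :=
  exist (fun F : gfun (pi1_over Y1) (pi1_over Y2) =>
    gfun_comp (gproj (pi1_over Y2)) F = gproj (pi1_over Y1)) _ pi1_gfun_over.

End Morphism.

Program Definition pi1_vert : functor (Top_sl1c B) (TopGpd_over X) :=
  @Functor (Top_sl1c B) (TopGpd_over X) pi1_over pi1_gmap _ _.
Next Obligation.
move=> Y; apply: sval_inj; apply: gfunP => // a.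
by rewrite /= -[RHS]pi1_reprK; exact: pi1_class_eq.
Qed.
Next Obligation.
move=> Y1 Y2 Y3 g f; apply: sval_inj; apply: gfunP => // a.
rewrite /= [RHS]pi1_map_class; exact: pi1_class_eq.
Qed.

End Pi1Functor.

Lemma cts_pi1_id_lpc (R : realType) (X : topologicalType)
    (B : chosen_bases R X) (Y : topologicalType) (p : Y -> X) :
  continuous (@pi1_id R X B Y p) -> locally_path_connected R Y.
Proof.
move=> ci.
pose joined (V : set Y) y y' := exists g : I01 R -> Y,
  [/\ continuous g, g i0 = y, g i1 = y' & forall s, V (g s)].
have near_joined (V : set Y) y : nbhs y V ->
    exists2 W : set Y, nbhs y W & forall y', W y' -> joined V y y'.
  move=> nV.
  have nc : nbhs (@pi1_id R X B Y p y) (varr_nbhs (vcst p y) setT V setT).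
    by apply: pi1_nbhs => //; exact: filterT.
  have nW := ci y _ nc; exists (@pi1_id R X B Y p @^-1` varr_nbhs (vcst p y) setT V setT) => //.
  move=> y' [k /= [h [ch _ [h0 h1] hV]] /vclassP ky'].
  have [/= ke _] := vhomotopic_ends ky'.
  exists (fun t => h (t, i0)); split.
  - apply: (cts_comp ch (f := fun t => (t, i0))).
    by apply: cts_pair; [exact: cts_id | exact: cts_cst].
  - exact: h0.
  - by rewrite h1 ke.
  - by move=> t; have [] := hV t.
have joined_trans V y y' y'' : joined V y y' -> joined V y' y'' -> joined V y y''.
  move=> [g [cg g0 g1 Vg]] [k [ck k0 k1 Vk]]; exists (pconcat g k); split.
  - by apply: cts_pconcat; rewrite ?k0.
  - by rewrite pconcat0.
  - by rewrite pconcat1.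
  - by move=> s; rewrite /pconcat; case: ifP.
have joined_sym V y y' : joined V y y' -> joined V y' y.
  move=> [g [cg g0 g1 Vg]]; exists (preverse g); split.
  - exact: cts_preverse.
  - by rewrite /preverse irev0.
  - by rewrite /preverse irev1.
  - by move=> s; exact: Vg.
have joined_sub V y (g : I01 R -> Y) : continuous g -> g i0 = y ->
    (forall s, V (g s)) -> forall t, joined V y (g t).
  move=> cg g0 Vg t; exists (fun s => g (lerp s i0 t)); split.
  - apply: (cts_comp cg); apply: cts_lerp; [exact: cts_id|exact: cts_cst|exact: cts_cst].
  - by rewrite lerp0.
  - by rewrite lerp1.
  - by move=> s; exact: Vg.
pose comp (V : set Y) y : set Y := [set y' | joined V y y'].
exists [set W | exists V y, [/\ open V, V y & W = comp V y]]; split; last first.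
  move=> _ [V [y [oV Vy ->]]] [y1 m1] [y2 m2].
  have j1 := set_mem m1; have j2 := set_mem m2.
  have j12 : joined V y1 y2 by apply: joined_trans j2; exact: joined_sym.
  move: (j12) => [g [cg g0 g1 Vg]].
  have jg s : g s \in comp V y.
    rewrite inE; apply: (joined_trans _ _ _ _ j1).
    exact: joined_sub cg g0 Vg s.
  exists (fun s => exist (fun x => x \in comp V y) _ (jg s)); split.
  - exact: cts_into.
  - exact: val_inj.
  - exact: val_inj.
split.
  move=> _ [V [y [oV Vy ->]]]; rewrite openE => y' jy'.
  have Vy' : V y' by move: jy' => [g [_ _ <-]].
  have [W nW Wj] := near_joined V y' (open_nbhs_nbhs (conj oV Vy')).
  by apply: filterS nW => z /Wj; exact: joined_trans.
move=> y A; rewrite nbhsE => -[V [oV Vy] VA].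
exists (comp V y); first split; first by exists V, y.
  by exists (fun=> y); split=> //; exact: cts_cst.
by move=> y' [g [_ _ <- Vg]]; exact/VA/Vg.
Qed.

(* Main.v *)
Require Import Defs.
From mathcomp Require Import all_boot all_order all_algebra.
From mathcomp Require Import all_classical all_reals topology normedtype.

(** An [n]-simplex [f : Delta^n * Y1 -> Y2] sends an arrow [((i, j), [g])] to the
    class of [s |-> f (e s, g s)], with [e] the straight edge from the [i]-th to
    the [j]-th vertex. Since [Delta^n] is convex, replacing [e] by any path with
    the same ends does not change the class; for the concatenation of two edges
    this gives functoriality. Affine maps preserve edges, hence naturality. *)

Set Implicit Arguments.
Unset Strict Implicit.
Unset Printing Implicit Defensive.

Import Order.TTheory GRing.Theory Num.Theory.
Import numFieldTopology.Exports.
Local Open Scope classical_set_scope.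
Local Open Scope ring_scope.

Local Notation proj := Defs.proj.

(** * Straight segments and edges in the standard simplex *)

Section Segment.
Context {R : realType} {n : nat}.
Local Notation I := (I01 R).

(** Convexity of the simplex: the coordinates stay nonnegative and add up to [(1 - t) + t]. *)
Lemma segment_subproof (x y : Delta R n) (t : I) :
  (1 - ival t) *: (val x : 'rV[R]_n.+1) + ival t *: (val y : 'rV[R]_n.+1)
    \in @std_simplex R n.
Proof.
have [x0 x1] := set_mem (valP x); have [y0 y1] := set_mem (valP y).
rewrite inE; split=> [i|].
  by rewrite !mxE addr_ge0 // mulr_ge0 ?subr_ge0 ?ival_le1 ?ival_ge0.
under eq_bigr do rewrite !mxE.
by rewrite big_split /= -!mulr_sumr x1 y1 !mulr1 subrK.
Qed.

Definition segment (x y : Delta R n) (t : I) : Delta R n :=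
  exist (fun z => z \in @std_simplex R n) _ (segment_subproof x y t).

Lemma segment0 x y : segment x y i0 = x.
Proof. by apply: val_inj; rewrite /= ival0 subr0 scale1r scale0r addr0. Qed.

Lemma segment1 x y : segment x y i1 = y.
Proof. by apply: val_inj; rewrite /= ival1 subrr scale0r scale1r add0r. Qed.

Lemma segmentxx x t : segment x x t = x.
Proof. by apply: val_inj; rewrite /= -scalerDl subrK scale1r. Qed.

Lemma cts_segment (Z : topologicalType) (x y : Z -> Delta R n) (t : Z -> I) :
  continuous x -> continuous y -> continuous t ->
  continuous (fun z => segment (x z) (y z) (t z)).
Proof.
move=> cx cy ct; apply: cts_into; apply: cts_mx => i j /=.
have cc (w : Z -> Delta R n) : continuous w ->
    continuous (fun z => (val (w z) : 'rV[R]_n.+1) i j).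
  move=> cw; apply: (cts_comp (@cts_mxcoord R 1 n.+1 i j)
    (f := fun z => val (w z) : 'rV[R]_n.+1)).
  by apply: cts_comp cw; exact: cts_val.
have cit : continuous (fun z => ival (t z)).
  by apply: cts_comp ct; exact: cts_ival.
under eq_fun do rewrite !mxE.
apply: cts_add; apply: cts_mul; try exact: cc; last exact: cit.
by apply: cts_add; [exact: cts_cst | exact: cts_opp].
Qed.

Definition edge (i j : 'I_n.+1) : I -> Delta R n :=
  segment (vertex R i) (vertex R j).

Lemma cts_edge i j : continuous (edge i j).
Proof. by apply: cts_segment; [exact: cts_cst|exact: cts_cst|exact: cts_id]. Qed.

Lemma edge0 i j : edge i j i0 = vertex R i.
Proof. exact: segment0. Qed.

Lemma edge1 i j : edge i j i1 = vertex R j.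
Proof. exact: segment1. Qed.

Lemma edgexx i s : edge i i s = vertex R i.
Proof. exact: segmentxx. Qed.

End Segment.

(** [Delta_map a] is the restriction of a linear map, so it preserves convex combinations. *)
Lemma Delta_map_segment (R : realType) m n (a : 'I_m.+1 -> 'I_n.+1)
    (x y : Delta R m) t :
  Delta_map a (segment x y t) = segment (Delta_map a x) (Delta_map a y) t.
Proof.
apply: val_inj; apply/rowP => j; rewrite /= !mxE.
under eq_bigr do rewrite !mxE.
by rewrite big_split /= -!mulr_sumr.
Qed.

Lemma Delta_map_vertex (R : realType) m n (a : 'I_m.+1 -> 'I_n.+1) i :
  Delta_map a (vertex R i) = vertex R (a i).
Proof.
apply: val_inj; apply/rowP => j; rewrite /= !mxE eqxx /=.
under eq_bigr do rewrite mxE eqxx /=.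
have [->|ji] := eqVneq j (a i).
  by rewrite (bigD1 i) //= eqxx big1 ?addr0 // => k /andP[_ /negPf->].
rewrite big1 // => k /eqP aj; case: eqVneq => // ki.
by rewrite -aj ki eqxx in ji.
Qed.

Lemma Delta_map_edge (R : realType) m n (a : 'I_m.+1 -> 'I_n.+1) i j (s : I01 R) :
  Delta_map a (edge i j s) = edge (a i) (a j) s.
Proof. by rewrite /edge Delta_map_segment !Delta_map_vertex. Qed.

#[local] Obligation Tactic := idtac.

(** Singletons of [T] are open. Continuity on a product with [codisc n] thus reduces to one vertex,
    or one pair of vertices, at a time. *)
Lemma cts_discretel (T : discreteTopologicalType) (Y Z : topologicalType)
    (g : T -> Y -> Z) :
  (forall t, continuous (g t)) -> continuous (fun z : T * Y => g z.1 z.2).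
Proof.
move=> cg [t y] S /cg nS; rewrite nbhs_simpl /=.
exists ([set t], g t @^-1` S).
  by split=> //=; rewrite nbhs_principalE; exact/principal_filterP.
by move=> [t' y'] [/= -> ].
Qed.

(** * The continuous functor induced by an [n]-simplex of maps over [X] *)

Section Simplex.
Context {R : realType} {X : topologicalType} {B : chosen_bases R X}.
Context {n : nat} {Y1 Y2 : sl1c_space B} (f : simplex_over n Y1 Y2).
Local Notation I := (I01 R).

Let cf : continuous (sval f) := (svalP f).1.
Let pf : forall z, proj (sval f z) = proj z.2 := (svalP f).2.

Lemma cts_simplex (Z : topologicalType) (u : Z -> Delta R n) (g : Z -> Y1) :
  continuous u -> continuous g -> continuous (fun z => sval f (u z, g z)).
Proof.
by move=> cu cg; apply: (cts_comp cf (f := fun z => (u z, g z))); exact: cts_pair.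
Qed.

Lemma vertical_simplex (u : I -> Delta R n) (g : I -> Y1) :
  vertical proj g -> vertical proj (fun s => sval f (u s, g s)).
Proof. by move=> vg s; rewrite !pf; exact: vg. Qed.

Definition simplex_vpath u (cu : continuous u) (g : vpath R proj) : vpath R proj :=
  VPath (cts_simplex cu (cts_vpath g)) (vertical_simplex u (vertical_vpath g)).

(** The straight-line homotopy from [u] to [v] runs alongside the given one from [g] to [k]. It
    stays vertical after [f], since [f] lies over [X] and the projection ignores the simplex
    coordinate. *)
Lemma simplex_vhomotopic (u v : I -> Delta R n) (g k : I -> Y1) :
  continuous u -> continuous v -> u i0 = v i0 -> u i1 = v i1 ->
  vhomotopic proj g k ->
  vhomotopic proj (fun s => sval f (u s, g s)) (fun s => sval f (v s, k s)).
Proof.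
move=> cu cv e0 e1 [H [cH [H0 H1] [E0 E1] vH]].
exists (fun z => sval f (segment (u z.2) (v z.2) z.1, H z)); split.
- apply: cts_simplex => //; apply: cts_segment; last exact: cts_fst.
  + by apply: cts_comp cu _; exact: cts_snd.
  + by apply: cts_comp cv _; exact: cts_snd.
- by split=> s /=; rewrite ?segment0 ?segment1 ?H0 ?H1.
- by split=> t /=; rewrite -?e0 -?e1 segmentxx ?E0 ?E1.
- by move=> t; exact: vertical_simplex.
Qed.

Definition simplex_arr (ij : 'I_n.+1 * 'I_n.+1) (a : pi1_arr B (@proj R X B Y1)) :
    pi1_arr B (@proj R X B Y2) :=
  pi1_class B (simplex_vpath (@cts_edge R n ij.1 ij.2) (vrepr a)).

(** Neither the chosen representative nor the straight edge matters, which leaves both free in later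
    computations. *)
Lemma simplex_arr_class ij (u : I -> Delta R n) (cu : continuous u)
    (g : vpath R proj) : u i0 = vertex R ij.1 -> u i1 = vertex R ij.2 ->
  simplex_arr ij (pi1_class B g) = pi1_class B (simplex_vpath cu g).
Proof.
move=> u0 u1; apply/pi1_classP.
apply: simplex_vhomotopic => //; rewrite ?edge0 ?edge1 //.
- exact: cts_edge.
- exact: vrepr_class.
Qed.

Lemma simplex_arr_edge ij (g : vpath R proj) :
  simplex_arr ij (pi1_class B g) = pi1_class B (simplex_vpath (@cts_edge R n ij.1 ij.2) g).
Proof. by apply: simplex_arr_class; rewrite ?edge0 ?edge1. Qed.

(** At the ends of a path the simplex coordinate is a fixed vertex, so [V0] and [V1] are pulled back
    along [f] at that vertex; [U] is kept because [f] lies over [X]. *)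
Lemma cts_simplex_arr ij : continuous (simplex_arr ij).
Proof.
apply: pi1_cts => a k U V0 V1; elim/(@pi1_classW _ _ B): a => g.
rewrite simplex_arr_edge => /pi1_classP gk BU B0 B1.
have [/= e0 e1] := vhomotopic_ends gk; rewrite edge0 in e0; rewrite edge1 in e1.
have cv i : continuous (fun y => sval f (vertex R i, y)).
  by apply: cts_simplex; [exact: cts_cst | exact: cts_id].
have ng := @pi1_nbhs _ _ B _ _ g U ((fun y => sval f (vertex R ij.1, y)) @^-1` V0)
  ((fun y => sval f (vertex R ij.2, y)) @^-1` V1).
apply: filterS (ng _ _ _); last first.
- by apply: cv; rewrite /= e1; exact: basic_nbhs_nbhs B1.
- by apply: cv; rewrite /= e0; exact: basic_nbhs_nbhs B0.
- have <- : proj (k i0) = proj (g i0) by rewrite -e0 pf.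
  exact: basic_nbhs_nbhs BU.
move=> _ [l /= gl <-]; rewrite [simplex_arr _ _]simplex_arr_edge; apply/varr_nbhsP.
(* [k] is an arbitrary representative of the image class: first join it to the image of [g] by a
   vertical homotopy, then apply [f] to the square from [g] to [l]. *)
apply: (square_trans (g := simplex_vpath (@cts_edge R n ij.1 ij.2) g)).
  apply: square_vhomotopic; [exact: BU.2|exact: B0.2|exact: B1.2|].
  exact: vhomotopic_sym.
move: gl => [h [ch Uh [h0 h1] hV]].
exists (fun z => sval f (edge ij.1 ij.2 z.2, h z)); split.
- apply: cts_simplex => //.
  by apply: (cts_comp (@cts_edge R n ij.1 ij.2)); exact: cts_snd.
- by move=> z; rewrite pf; exact: Uh.
- by split=> s /=; rewrite ?h0 ?h1.
- by move=> t; rewrite /= edge0 edge1; exact: hV.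
Qed.

Lemma simplex_arr_src ij a :
  pi1_src (simplex_arr ij a) = sval f (vertex R ij.1, pi1_src a).
Proof. by rewrite [LHS]pi1_src_class /= edge0. Qed.

Lemma simplex_arr_tgt ij a :
  pi1_tgt (simplex_arr ij a) = sval f (vertex R ij.2, pi1_tgt a).
Proof. by rewrite [LHS]pi1_tgt_class /= edge1. Qed.

Lemma simplex_arr_id i y :
  simplex_arr (i, i) (pi1_id B proj y) = pi1_id B proj (sval f (vertex R i, y)).
Proof.
by rewrite [LHS]simplex_arr_edge; apply: pi1_class_eq => s; rewrite /= edgexx.
Qed.

(** The broken path from [i] through [j] to [k] may replace the edge from [i] to [k]. With it, the
    image of the concatenation is pointwise the concatenation of the images. *)
Lemma simplex_arr_comp i j k a b (e : pi1_tgt a = pi1_src b) e' :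
  simplex_arr (i, k) (pi1_comp e) =
    @pi1_comp _ _ B _ _ (simplex_arr (i, j) a) (simplex_arr (j, k) b) e'.
Proof.
have ce : continuous (pconcat (edge i j) (edge j k) : I -> Delta R n).
  by apply: cts_pconcat; rewrite ?edge0 ?edge1 //; exact: cts_edge.
rewrite [LHS](simplex_arr_class (u := pconcat (edge i j) (edge j k)) ce);
  rewrite ?pconcat0 ?pconcat1 ?edge0 ?edge1 //.
have e1 : simplex_vpath (@cts_edge R n i j) (vrepr a) i1 =
    simplex_vpath (@cts_edge R n j k) (vrepr b) i0.
  by rewrite /= edge0 edge1; congr (sval f (_, _)); exact: e.
rewrite (pi1_comp_eq e' e1 erefl erefl); apply: pi1_class_eq => s.
by rewrite /= /pconcat; case: ifP.
Qed.

Lemma cts_simplex_ob :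
  continuous (fun x : gob (gprod (codisc n) (pi1_of Y1)) =>
    sval f (vertex R x.1, x.2)).
Proof.
apply: (@cts_discretel (discrete_topology 'I_n.+1) Y1 Y2
  (fun i y => sval f (vertex R i, y))) => i.
by apply: cts_simplex; [exact: cts_cst | exact: cts_id].
Qed.

Lemma cts_simplex_arr_prod :
  continuous (fun a : garr (gprod (codisc n) (pi1_of Y1)) =>
    simplex_arr a.1 a.2 : garr (pi1_of Y2)).
Proof.
apply: (@cts_discretel (discrete_topology ('I_n.+1 * 'I_n.+1)%type)
  (garr (pi1_of Y1)) (garr (pi1_of Y2)) simplex_arr) => ij.
exact: cts_simplex_arr.
Qed.

Program Definition simplex_gfun : gfun (gprod (codisc n) (pi1_of Y1)) (pi1_of Y2) :=
  @GFun (gprod (codisc n) (pi1_of Y1)) (pi1_of Y2)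
    (fun x => sval f (vertex R x.1, x.2)) (fun a => simplex_arr a.1 a.2)
    cts_simplex_ob cts_simplex_arr_prod _ _ _ _.
Next Obligation. by move=> a; exact: simplex_arr_src. Qed.
Next Obligation. by move=> a; exact: simplex_arr_tgt. Qed.
Next Obligation. by move=> x; exact: simplex_arr_id. Qed.
Next Obligation.
(* Composability in the [codisc n] factor identifies the two middle vertices. *)
move=> [[i j] a] [[j' k] b] e e'; have [/= ij ab] := e; subst j'.
exact: simplex_arr_comp.
Qed.

Lemma simplex_gfun_over : gfun_comp (pi1_proj Y2) simplex_gfun =
  gfun_comp (pi1_proj Y1) (gsnd (codisc n) (pi1_of Y1)).
Proof.
apply: gfunP => [x|a] /=; first exact: pf.
by rewrite simplex_arr_src pf.
Qed.

Definition pi1_simplex : gsimplex_over n (pi1_over Y1) (pi1_over Y2) :=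
  exist (fun F : gfun (gprod (codisc n) (pi1_over Y1)) (pi1_over Y2) =>
    gfun_comp (gproj (pi1_over Y2)) F =
    gfun_comp (gproj (pi1_over Y1)) (gsnd (codisc n) (pi1_over Y1)))
  _ simplex_gfun_over.

End Simplex.

Theorem proposition3p5 (R : realType) (X : topologicalType)
    (hX : locally_one_connected R X) (B : chosen_bases R X) :
  is_simplicial_functor (Top_sl1c_enrichment B) (TopGpd_enrichment X)
    (pi1_vert B).
Proof.
exists (fun n Y1 Y2 f => @pi1_simplex R X B n Y1 Y2 f); split.
- move=> m n Y1 Y2 a f; apply: sval_inj; apply: gfunP => [[i y]|[[i j] g]] /=.
    by rewrite Delta_map_vertex.
  by apply: pi1_class_eq => s; rewrite /= Delta_map_edge.
(* A map seen as a 0-simplex ignores the simplex coordinate, so the edge disappears. *)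
- move=> Y1 Y2 f; apply: sval_inj; apply: gfunP => [[i y]|[ij g]] //=.
  exact: pi1_class_eq.
(* The diagonal feeds the same edge [e] to [f] and [g]: both sides are the class of
   [s |-> g (e s, f (e s, k s))]. *)
- move=> n Y1 Y2 Y3 g f; apply: sval_inj; apply: gfunP => [[i y]|[ij k]] //=.
  by rewrite [RHS]simplex_arr_edge; exact: pi1_class_eq.
- move=> n Y; apply: sval_inj; apply: gfunP => [[i y]|[ij g]] //=.
  by rewrite -[RHS]pi1_reprK; exact: pi1_class_eq.
Qed.
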